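(* Let $1\le d\le N$ be integers, $t>0$, and $z=e^{-t/2}$. The microchiral partition function $Z_N^d$ of two-dimensional Yang--Mills theory with gauge group $\mathrm{U}_N$ on a sphere of area $t$ admits the absolutely convergent series expansion $$Z_N^d=\frac{(zN^2)^d}{d!}\sum_{a,b=0}^{d-1}\frac{1}{N^{a+b}}\sum_{r=0}^\infty\frac{(-t)^r}{r!\,N^r}\langle L_aK^rL_b\rangle,$$ where $\langle L_aK^rL_b\rangle$ is a coarse double Hurwitz number, i.e. the number of $r$-step walks in the Hurwitz--Cayley graph $\mathrm{S}^d$ which begin at a point of $L_a$ and end at a point of $L_b$.
   Context: $\mathsf{Y}^d_N$ is the set of Young diagrams with exactly $d$ cells and at most $N$ rows. For $\lambda\in\mathsf{Y}^d_N$, $\mathbf{W}_N^\lambda$ is the irreducible representation of the unitary group $\mathrm{U}_N$ with highest weight $\lambda$, and $\hat C(\lambda)=\sum_{i=1}^N\lambda_i(\lambda_i+N+1-2i)$ is the corresponding eigenvalue of the quadratic Casimir. The microchiral partition function of the sphere (no holes, no handles) is $$Z_N^d=\sum_{\lambda\in\mathsf{Y}^d_N}(\dim\mathbf{W}_N^\lambda)^2e^{-\frac{t}{2N}\hat C(\lambda)}.$$ The Hurwitz--Cayley graph has vertex set the symmetric group $\mathrm{S}^d$, with $\rho,\sigma$ adjacent if and only if $\sigma=\rho\tau$ for a transposition $\tau$. For $0\le a\le d-1$, $L_a$ is the set of permutations in $\mathrm{S}^d$ with exactly $d-a$ disjoint cycles (equivalently, at distance $a$ from the identity), and also the sum of these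 permutations in $\mathbb{C}\mathrm{S}^d$; $K$ is the sum of all transpositions. For $A\in\mathbb{C}\mathrm{S}^d$, $\langle A\rangle$ denotes the coefficient of the identity permutation in $A$. *)

(* Defs.v *)
From HB Require Import structures.
From mathcomp Require Import all_boot all_order all_algebra all_fingroup.
From mathcomp Require Import all_character.
From mathcomp Require Import all_classical all_reals all_analysis.
From mathcomp Require Import spectral complex.

Set Implicit Arguments.
Unset Strict Implicit.
Unset Printing Implicit Defensive.

Import Order.TTheory GRing.Theory Num.Theory.
Import numFieldNormedType.Exports.

Local Open Scope classical_set_scope.
Local Open Scope ring_scope.

Section UnitaryRepresentations.
Variable C : numClosedFieldType.

(* A finite-dimensional continuous representation of U_N on column vectors;
   only the values of [urep_map] on unitary matrices are meaningful. *)
Record unitary_rep (N : nat) := UnitaryRep {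
  urep_dim : nat;
  urep_map :> 'M[C]_N -> 'M[C]_urep_dim;
  urep1 : urep_map 1%:M = 1%:M;
  urepM : {in @unitarymx C N N &,
    {morph urep_map : A B / A *m B >-> A *m B}};
  urep_continuous :
    {within [set A | A \is @unitarymx C N N], continuous urep_map} }.

Definition urep_irreducible N (rho : unitary_rep N) : Prop :=
  (0 < urep_dim rho)%N /\
  forall U : {vspace 'cV[C]_(urep_dim rho)},
    (forall A v, A \is @unitarymx C N N -> v \in U -> rho A *m v \in U) ->
    U = 0%VS \/ U = fullv.

(* The weight mu is the character diag(u_1, ..., u_N) |-> \prod_i u_i ^ mu_i
   of the diagonal torus of U_N. *)
Definition is_weight N (rho : unitary_rep N) (mu : 'I_N -> int) : Prop :=
  exists2 v : 'cV[C]_(urep_dim rho), v != 0 &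
    forall u : 'rV[C]_N, (forall i, `|u 0 i| = 1) ->
      rho (diag_mx u) *m v = (\prod_i u 0 i ^ mu i) *: v.

(* lam - mu = \sum_(i < j) c_ij (e_i - e_j) with all c_ij natural numbers: a
   nonnegative integral combination of the positive roots e_i - e_j, i < j. *)
Definition weight_le N (mu lam : 'I_N -> int) : Prop :=
  exists c : 'I_N -> 'I_N -> nat, forall k,
    lam k - mu k = \sum_(j < N | (k < j)%N) (c k j)%:Z
                   - \sum_(i < N | (i < k)%N) (c i k)%:Z.

Definition has_highest_weight N (rho : unitary_rep N) (lam : 'I_N -> int) :
    Prop :=
  is_weight rho lam /\ forall mu, is_weight rho mu -> weight_le mu lam.

End UnitaryRepresentations.

(* A diagram with d cells and at most N rows is the sequence of its N row
   lengths, padded with zeros; each length is at most d. *)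
Definition young (N d : nat) : {set {ffun 'I_N -> 'I_d.+1}} :=
  [set l : {ffun 'I_N -> 'I_d.+1} |
    [forall i : 'I_N, forall j : 'I_N, (i <= j)%N ==> (l j <= l i)%N]
    && (\sum_i (l i : nat) == d)%N].

(* Rows are numbered from 0 here, whence [i.+1]. *)
Definition casimir N (lam : 'I_N -> int) : int :=
  \sum_(i < N) lam i * (lam i + N%:Z + 1 - 2 * (i.+1)%:Z).

Definition row_lengths N d (l : {ffun 'I_N -> 'I_d.+1}) (i : 'I_N) : int :=
  (l i : nat)%:Z.

Definition microchiral (R : realType) N d (t : R)
    (W : {ffun 'I_N -> 'I_d.+1} -> unitary_rep R[i] N) : R :=
  \sum_(l in young N d)
     (urep_dim (W l))%:R ^+ 2
     * expR (- (t / (2 * N%:R)) * (casimir (row_lengths l))%:~R).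

Definition transpositions d : {set 'S_d} :=
  [set tperm p.1 p.2 | p : 'I_d * 'I_d & p.1 != p.2].

(* [porbits s] contains the singleton orbits, so fixed points count as
   cycles. *)
Definition level d (a : nat) : {set 'S_d} :=
  [set s : 'S_d | #|porbits s| == (d - a)%N].

Definition hc_adj d : rel 'S_d :=
  fun rho sigma => [exists tau in transpositions d, sigma == (rho * tau)%g].

Definition walks d (a b r : nat) : nat :=
  #|[set w : 'S_d * r.-tuple 'S_d |
      [&& w.1 \in level d a, path (@hc_adj d) w.1 w.2
        & last w.1 w.2 \in level d b]]%SET|.

(* The group algebra of S_d over F is the library's [group_ring]: elements are
   represented by their matrices in the regular representation, [gset_mx] is
   the sum of a set of group elements and [gring_row] recovers coefficients. *)
Definition set_sum (F : fieldType) d (A : {set 'S_d}) :=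
  gset_mx F [set: 'S_d]%G A.

Definition coef_id (F : fieldType) d (A : 'M[F]_#|[set: 'S_d]%G|) : F :=
  gring_row A 0 (gring_index [set: 'S_d]%G 1%g).

(* < L_a K^r L_b > *)
Definition hurwitz (F : fieldType) d (a b r : nat) : F :=
  coef_id (set_sum F (level d a) *m set_sum F (transpositions d) ^+ r
           *m set_sum F (level d b)).

(* Main.v *)
(** Let B be the commutant of S_d in End(V^{(x)d}), V = C^N.  It is spanned by
    the operators g^{(x)d}, g unitary.  The character of the given
    representation W_l is a symmetric polynomial, homogeneous of degree d, in
    the eigenvalues of g, hence a linear function of g^{(x)d}; it follows that
    W_l extends to a simple B-module.  Comparing highest weights, the map
    B -> \prod_l End(W_l) is onto; as the characters of the W_l span the
    symmetric polynomials of degree d, it is also injective.  The sum K of the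
    transpositions acts on W_l by the content c(l) of l, which gives the
    eigenvalue of the Casimir, so that \sum_l (dim W_l)^2 c(l)^r is the trace of
    multiplication by K^r on B.  Averaging over S_d, this trace is also
    (1/d!) \sum_s tr(K^r s) tr(s^{-1}); since tr(s) is N to the number of cycles
    of s, it counts the walks between the levels of the Hurwitz-Cayley graph. *)
Require Import Defs.
From HB Require Import structures.
From mathcomp Require Import all_boot all_order all_algebra all_fingroup.
From mathcomp Require Import all_character.
From mathcomp Require Import all_classical all_reals all_analysis.
From mathcomp Require Import spectral complex zify ring lra.

Set Implicit Arguments.
Unset Strict Implicit.
Unset Printing Implicit Defensive.

Import Order.TTheory GRing.Theory Num.Theory.
Import numFieldNormedType.Exports.

Local Open Scope ring_scope.

(** * Linear algebra *)

(** The obstacle is that each [W l] is given abstractly, as a continuous irreducible representation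
    with a highest weight: neither a character formula nor a dimension formula nor polynomiality is
    at hand. Polynomiality is recovered on the torus. Continuity forces the torus to act through
    integral weights; the highest weight makes the entries of every weight add up to d, and Weyl
    group symmetry makes them nonnegative. The dimension of [W l] enters only as the size of a
    matrix block. A representation is meaningful on unitary matrices only, so whatever is
    transported from the commutant to [W l] (weight projectors, matrix units, K) has to be a
    combination of g^{(x)d} with g unitary. The Casimir eigenvalue is 2 c(l) + N d. Its part N d
    gives the factor z^d and leaves exp(- t c(l) / N), whose Taylor coefficients are the moments of
    c(l). The two traces contribute N^(d-a) and N^(d-b), whence N^(2d) and N^-(a+b). *)

Section LinearAlgebra.

(** A free family of maximal size, which exists because sizes are bounded by the dimension. [G] may
    be infinite: it will be the unitary group or a dense set of angles. *)
Lemma spanning_family (F : fieldType) (V : vectType F) (G : eqType)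
    (P : G -> Prop) (f : G -> V) :
  exists gs : seq G, [/\ free (map f gs), {in gs, forall g, P g} &
    forall g, P g -> f g \in <<map f gs>>%VS].
Proof.
pose Q k := `[< exists gs : seq G,
  [/\ free (map f gs), {in gs, forall g, P g} & size gs = k] >].
have Q0 : exists k, Q k.
  by exists 0%N; apply/asboolP; exists [::]; split => //; rewrite nil_free.
have Qb k : Q k -> (k <= \dim {:V})%N.
  move=> /asboolP[gs [fr _ <-]]; rewrite -(size_map f) -(eqnP fr).
  by rewrite dimvS ?subvf.
case: (ex_maxnP Q0 Qb) => k /asboolP[gs [fr gsP sz]] maxk.
exists gs; split => // g Pg; apply/negPn/negP => ng.
suff /maxk : Q k.+1 by rewrite ltnn.
apply/asboolP; exists (g :: gs); split; last by rewrite /= sz.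
  by rewrite /= free_cons ng fr.
by move=> h; rewrite inE => /orP[/eqP->|/gsP].
Qed.

Lemma linear_extension (F : fieldType) (V V' : vectType F) (G : eqType)
    (P : G -> Prop) (f : G -> V) (h : G -> V') :
  (forall (m : nat) (c : 'I_m -> F) (g : 'I_m -> G), (forall i, P (g i)) ->
    \sum_i c i *: f (g i) = 0 -> \sum_i c i *: h (g i) = 0) ->
  exists L : {linear V -> V'}, forall g, P g -> L (f g) = h g.
Proof.
move=> rel; have [gs [fr gsP span]] := spanning_family P f.
pose n := size gs.
have szn : size (map f gs) == n by rewrite size_map.
pose X := Tuple szn.
pose Y := [tuple h (tnth (in_tuple gs) i) | i < n].
pose L x := \sum_(i < n) coord X i x *: Y`_i.
have Llin : linear L.
  move=> a x y; rewrite /L scaler_sumr -big_split; apply: eq_bigr => i _ /=.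
  by rewrite linearP scalerDl scalerA.
pose LL := GRing.isLinear.Build _ _ _ _ L Llin.
pose L' : {linear V -> V'} := HB.pack L LL.
exists L' => g Pg /=.
have /coord_span Eg : f g \in <<X>>%VS by exact: span.
(* The relation fed to [rel] is the expansion of [f g] in the free family minus [f g] itself, which
   sits at index 0 with coefficient -1. *)
pose c (i : 'I_n.+1) := if unlift ord0 i is Some j then coord X j (f g) else -1.
pose gg (i : 'I_n.+1) :=
  if unlift ord0 i is Some j then tnth (in_tuple gs) j else g.
have ggP i : P (gg i).
  rewrite /gg; case: unliftP => [j _|_] //.
  by apply: gsP; rewrite mem_tnth.
have E0 : \sum_(i < n) coord X i (f g) *: f (tnth (in_tuple gs) i) = f g.
  rewrite {2}Eg; apply: eq_bigr => i _; congr (_ *: _).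
  by rewrite (nth_map g) //= (tnth_nth g).
have lE (W : lmodType F) (k : G -> W) : \sum_i c i *: k (gg i) =
    - k g + \sum_(i < n) coord X i (f g) *: k (tnth (in_tuple gs) i).
  rewrite big_ord_recl /c /gg unlift_none scaleN1r; congr (_ + _).
  by apply: eq_bigr => i _; rewrite liftK.
have := rel n.+1 c gg ggP; rewrite !lE E0 addNr => /(_ erefl) /eqP.
rewrite addrC subr_eq0 => /eqP <-.
by apply: eq_bigr => i _; congr (_ *: _); rewrite -tnth_nth tnth_mktuple.
Qed.

(** Burnside's theorem on irreducible matrix algebras. A nonzero T of minimal rank in [U] has rank
    one; since [U] moves any nonzero column to any column and, dually, the row of T to any row, the
    products B T D give all matrix units. *)
Lemma burnside (C : numClosedFieldType) n (U : {vspace 'M[C]_n}) :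
  1%:M \in U -> (forall A B, A \in U -> B \in U -> A *m B \in U) ->
  (forall W : {vspace 'cV[C]_n},
    (forall A v, A \in U -> v \in W -> A *m v \in W) -> W = 0%VS \/ W = fullv) ->
  forall A, A \in U.
Proof.
case: n U => [|n] U U1 UM irr A; first by rewrite [A]flatmx0 mem0v.
have cyc (v w : 'cV[C]_n.+1) : v != 0 -> exists2 B, B \in U & w = B *m v.
  move=> v0; pose f := fun B : 'M[C]_n.+1 => B *m v.
  have flin : linear f by move=> a B D; rewrite /f mulmxDl scalemxAl.
  pose LL := GRing.isLinear.Build _ _ _ _ f flin.
  pose f' : {linear 'M[C]_n.+1 -> 'cV[C]_n.+1} := HB.pack f LL.
  have [|W0|WT] := irr (linfun f' @: U)%VS.
  - move=> B x BU /memv_imgP[D DU ->]; rewrite !lfunE /= /f mulmxA.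
    by rewrite -[_ *m v]/(f' _) -lfunE memv_img ?UM.
  - have : v \in (linfun f' @: U)%VS.
      by apply/memv_imgP; exists 1%:M => //; rewrite lfunE /= /f mul1mx.
    by rewrite W0 memv0 (negPf v0).
  - have : w \in (linfun f' @: U)%VS by rewrite WT memvf.
    by case/memv_imgP => B BU ->; exists B; rewrite // lfunE.
pose Q k := `[< exists T, [/\ T \in U, T != 0 & \rank T = k] >].
have Q0 : exists k, Q k.
  exists n.+1; apply/asboolP; exists 1%:M.
  by rewrite U1 mxrank1; split => //; exact: oner_neq0.
case: (ex_minnP Q0) => r /asboolP[T [TU T0 rT]] minr.
(* With c an eigenvalue of the compression of T B to the row space of T, T B T - c T has smaller
   rank than T, so it vanishes by minimality. *)
have TBT B : B \in U -> exists c, T *m B *m T = c *: T.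
  move=> BU; pose M := row_base T *m B *m col_base T.
  have r0 : (0 < \rank T)%N by rewrite lt0n mxrank_eq0.
  have [c /eigenvalueP[u uM u0]] := eigenvalue_closed M r0.
  exists c; apply/eqP; rewrite -subr_eq0; apply/negPn/negP => D0.
  have := minr (\rank (T *m B *m T - c *: T)).
  have -> : Q (\rank (T *m B *m T - c *: T)).
    by apply/asboolP; eexists; split; [|exact: D0|by []]; rewrite memvB ?memvZ ?UM.
  move=> /(_ isT); rewrite leqNgt => /negP; apply.
  have -> : T *m B *m T - c *: T = col_base T *m (M - c%:M) *m row_base T.
    rewrite mulmxBr mulmxBl mul_mx_scalar -scalemxAl mulmx_base; congr (_ - _).
    by rewrite -{1 2}(mulmx_base T) /M !mulmxA.
  apply: leq_ltn_trans (mxrankM_maxl _ _) _.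
  apply: leq_ltn_trans (mxrankM_maxr _ _) _.
  rewrite -rT ltn_neqAle rank_leq_row andbT.
  apply/negP => /(@row_freeP _ _ _ _)[D MD].
  move/eqP: u0; apply; rewrite -[u]mulmx1 -MD mulmxA mulmxBr uM.
  by rewrite mul_mx_scalar subrr mul0mx.
have [j Tj] : exists j, col j T != 0.
  apply: contrapT => h; move/eqP: T0; apply; apply/matrixP => i j.
  have /eqP/matrixP/(_ i 0) : col j T == 0 by apply/negPn/negP => e; apply: h; exists j.
  by rewrite !mxE.
set w := col j T in Tj.
have Ty (k : 'I_n.+1) : exists c, col k T = c *: w.
  have [B BU E] := cyc w (delta_mx k 0) Tj.
  have [c Ec] := TBT B BU; exists c.
  by rewrite colE E /w [col j T]colE !mulmxA Ec scalemxAl.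
have [rr rrP] := choice Ty.
pose r1 : 'rV[C]_n.+1 := \row_k rr k.
have ET : T = w *m r1.
  apply/matrixP => i k; rewrite !mxE big_ord1 !mxE.
  by have /matrixP/(_ i 0) := rrP k; rewrite !mxE mulrC.
have r10 : r1 != 0 by apply: contraNneq T0 => r10; rewrite ET r10 mulmx0.
have cyr (s : 'rV[C]_n.+1) : exists2 B, B \in U & s = r1 *m B.
  pose f := fun B : 'M[C]_n.+1 => r1 *m B.
  have flin : linear f by move=> a B D; rewrite /f mulmxDr scalemxAr.
  pose LL := GRing.isLinear.Build _ _ _ _ f flin.
  pose f' : {linear 'M[C]_n.+1 -> 'rV[C]_n.+1} := HB.pack f LL.
  pose I := (linfun f' @: U)%VS.
  suff IT : I = fullv.
    have : s \in I by rewrite IT memvf.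
    by case/memv_imgP => B BU ->; exists B; rewrite // lfunE.
  (* A proper space of rows is killed by some nonzero column v. Moving v by [U] to the conjugate
     transpose of [r1] makes the squared norm of [r1] zero. *)
  apply/eqP; rewrite eqEdim subvf /= dimvf /dim /= mul1n leqNgt; apply/negP => dI.
  pose M := \matrix_(i < \dim I) (vbasis I)`_i.
  have : cokermx M != 0.
    rewrite -mxrank_eq0 mxrank_coker -lt0n subn_gt0.
    by apply: leq_ltn_trans (rank_leq_row _) dI.
  move=> K0; have [k Kk] : exists k, col k (cokermx M) != 0.
    apply: contrapT => h; move/eqP: K0; apply; apply/matrixP => i k.
    have /eqP/matrixP/(_ i 0) : col k (cokermx M) == 0.
      by apply/negPn/negP => e; apply: h; exists k.
    by rewrite !mxE.
  set v := col k _ in Kk.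
  have Mv : M *m v = 0 by rewrite /v colE mulmxA mulmx_coker mul0mx.
  have Iv x : x \in I -> x *m v = 0.
    move=> xI; rewrite (coord_vbasis xI) mulmx_suml big1 // => i _.
    rewrite -scalemxAl; have /(congr1 (row i)) := Mv.
    by rewrite row_mul rowK row0 => ->; rewrite scaler0.
  have [B BU Ew] := cyc v (r1^T ^ Num.conj)%sesqui Kk.
  have : r1 *m (r1^T ^ Num.conj)%sesqui = 0.
    rewrite Ew mulmxA Iv // -[r1 *m B]/(f' B) -lfunE memv_img //.
  move/matrixP/(_ 0 0); rewrite !mxE => /eqP.
  rewrite psumr_eq0 => [|i _]; last by rewrite !mxE -normCK exprn_ge0.
  move=> /allP z; move/eqP: r10; apply; apply/matrixP => i0 i; rewrite ord1 mxE.
  have := z i (mem_index_enum _); rewrite !mxE -normCK sqrf_eq0 normr_eq0.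
  by move/eqP=> e; rewrite -[RHS]e ?mxE.
rewrite [A]matrix_sum_delta; apply: memv_suml => i _; apply: memv_suml => k _.
apply: memvZ; have [B BU E1] := cyc w (delta_mx i 0) Tj.
have [D DU E2] := cyr (delta_mx 0 k).
have -> : delta_mx i k = B *m T *m D.
  by rewrite ET mulmxA -mulmxA -E1 -E2 mul_delta_mx.
by rewrite !UM.
Qed.

End LinearAlgebra.

(** * Roots of unity and tensor powers *)

Section RootsOfUnity.
Variable F : fieldType.

Lemma primitive_root_pow2 k (z : F) : (2%:R != 0 :> F) ->
  z ^+ (2 ^ k) = -1 -> (2 ^ k.+1).-primitive_root z.
Proof.
move=> nz2 zk.
have zk1 : z ^+ (2 ^ k.+1) = 1 by rewrite expnSr exprM zk -signr_odd expr0.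
have [m zm] := prim_order_exists (expn_gt0 2 k.+1) zk1.
move=> /(dvdn_pfactor _ _ (isT : prime 2))[j].
rewrite leq_eqVlt => /orP[/eqP-> <-//|jk Em].
have : z ^+ (2 ^ k) = 1.
  apply/eqP; rewrite -(prim_order_dvd zm) Em.
  by rewrite dvdn_exp2l.
rewrite zk => /eqP; rewrite eq_sym -subr_eq0 opprK.
by rewrite (negPf nz2).
Qed.

Lemma sum_prim_root_expr m (z : F) (a b : nat) : m.-primitive_root z ->
  (a < m)%N -> (b < m)%N ->
  \sum_(j < m) z ^+ (j * a) / z ^+ (j * b) = if a == b then m%:R else 0.
Proof.
move=> zm am bm.
have z0 : z != 0.
  apply/eqP => z0; have := prim_expr_order zm.
  rewrite z0 expr0n; case: eqP => [m0|_ /eqP]; last by rewrite eq_sym oner_eq0.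
  by move: am; rewrite m0.
pose w := z ^+ a / z ^+ b.
have E (j : 'I_m) : z ^+ (j * a) / z ^+ (j * b) = w ^+ j.
  by rewrite exprMn exprVn -!exprM ![(_ * j)%N]mulnC.
rewrite (eq_bigr _ (fun j _ => E j)).
have wE : (w == 1) = (a == b).
  rewrite /w -{1}(mulfV (expf_neq0 b z0)) (inj_eq (mulIf _)) ?invr_eq0 ?expf_neq0 //.
  by rewrite (eq_prim_root_expr zm) !modn_small.
case: eqP => [/eqP|] ab.
  move: ab; rewrite -wE => /eqP->.
  by under eq_bigr do rewrite expr1n; rewrite sumr_const card_ord.
have w1 : w - 1 != 0 by rewrite subr_eq0 wE; apply/eqP.
apply: (mulfI w1); rewrite mulr0 -subrX1 exprMn exprVn -!exprM ![(_ * m)%N]mulnC.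
by rewrite !exprM (prim_expr_order zm) !expr1n invr1 mulr1 subrr.
Qed.

Lemma fourier_orthogonality m (z : F) N (a b : 'I_N -> nat) :
  m.-primitive_root z -> (forall i, (a i < m)%N) -> (forall i, (b i < m)%N) ->
  \sum_(h : {ffun 'I_N -> 'I_m}) \prod_i (z ^+ (h i * a i) / z ^+ (h i * b i))
  = if [forall i, a i == b i] then m%:R ^+ N else 0.
Proof.
move=> zm am bm.
rewrite -(bigA_distr_bigA (fun i (j : 'I_m) => z ^+ (j * a i) / z ^+ (j * b i))).
under eq_bigr do rewrite sum_prim_root_expr //.
case: ifPn => [/forallP ab|].
  under eq_bigr do rewrite (eqP (ab _)) eqxx.
  by rewrite prodr_const card_ord.
rewrite negb_forall => /existsP[i abi].
by rewrite (bigD1 i) //= (negPf abi) mul0r.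
Qed.

End RootsOfUnity.

(** Powers of two are enough: they exceed any d, and they are the orders met when an angle is halved
    repeatedly. *)
Lemma exists_prim_root_pow2 (C : numClosedFieldType) k :
  exists z : C, (2 ^ k.+1).-primitive_root z.
Proof.
exists ((2 ^ k).-root (-1)); apply: primitive_root_pow2.
  by rewrite pnatr_eq0.
by rewrite rootCK // expn_gt0.
Qed.

Lemma norm_prim_root (C : numClosedFieldType) m (z : C) :
  m.-primitive_root z -> `|z| = 1.
Proof.
move=> zm; have m0 := prim_order_gt0 zm.
apply: (pexpIrn m0); rewrite ?nnegrE //.
by rewrite -normrX (prim_expr_order zm) normr1 expr1n.
Qed.

Section MultiIndex.
Variables (F : comNzRingType) (T : finType).

(** Matrices indexed by a finite type, so that entries on a tensor power are addressed by
    multi-indices while the matrix algebra of ordinals remains available. *)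
Definition mxT (f : T -> T -> F) : 'M[F]_#|T| :=
  \matrix_(i, j) f (enum_val i) (enum_val j).

Definition ent (X : 'M[F]_#|T|) (I J : T) : F := X (enum_rank I) (enum_rank J).

Lemma entE f I J : ent (mxT f) I J = f I J.
Proof. by rewrite /ent mxE !enum_rankK. Qed.

Lemma ent_inj X Y : (forall I J, ent X I J = ent Y I J) -> X = Y.
Proof.
move=> e; apply/matrixP => i j.
by rewrite -(enum_valK i) -(enum_valK j); exact: e.
Qed.

Lemma entD X Y I J : ent (X + Y) I J = ent X I J + ent Y I J.
Proof. by rewrite /ent mxE. Qed.

Lemma entZ c X I J : ent (c *: X) I J = c * ent X I J.
Proof. by rewrite /ent mxE. Qed.

Lemma ent_sum (K : finType) (P : pred K) (X : K -> 'M[F]_#|T|) I J :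
  ent (\sum_(k | P k) X k) I J = \sum_(k | P k) ent (X k) I J.
Proof. by rewrite /ent summxE. Qed.

Lemma ent1 I J : ent 1%:M I J = (I == J)%:R.
Proof. by rewrite /ent mxE (inj_eq enum_rank_inj). Qed.

Lemma sum_enum_rank (G : 'I_#|T| -> F) : \sum_i G i = \sum_I G (enum_rank I).
Proof.
rewrite (reindex (fun I : T => enum_rank I)) //.
by exists enum_val => i _; rewrite ?enum_rankK ?enum_valK.
Qed.

Lemma entM X Y I J : ent (X *m Y) I J = \sum_K ent X I K * ent Y K J.
Proof. by rewrite /ent mxE sum_enum_rank. Qed.

Lemma mxtrace_ent X : \tr X = \sum_I ent X I I.
Proof. by rewrite /mxtrace sum_enum_rank. Qed.

End MultiIndex.

Section TensorPower.
Variables (C : numClosedFieldType) (d N : nat).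
Local Notation T := {ffun 'I_d -> 'I_N}.

Definition tens (g : 'M[C]_N) : 'M[C]_#|T| :=
  mxT (fun I J : T => \prod_k g (I k) (J k)).

Lemma tensM g h : tens (g *m h) = tens g *m tens h.
Proof.
apply: ent_inj => I J; rewrite entM entE.
under eq_bigr do rewrite mxE.
rewrite bigA_distr_bigA; apply: eq_bigr => K _.
by rewrite !entE big_split.
Qed.

Lemma prodr_eqb (I J : T) : \prod_k ((I k == J k)%:R : C) = (I == J)%:R.
Proof.
case: eqP => [->|ne]; first by rewrite big1 // => k _; rewrite eqxx.
have [k] : exists k, I k != J k.
  apply/existsP; rewrite -negb_forall; apply/negP => /forallP h.
  by apply: ne; apply/ffunP => k; apply/eqP/h.
by rewrite (bigD1 k) //= => /negPf->; rewrite mul0r.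
Qed.

Lemma tens1 : tens 1%:M = 1%:M.
Proof.
apply: ent_inj => I J; rewrite entE ent1 -prodr_eqb.
by apply: eq_bigr => k _; rewrite mxE.
Qed.

Definition icomp (I : T) (s : 'S_d) : T := [ffun k => I (s k)].

Lemma icompK s : cancel (icomp^~ s) (icomp^~ s^-1%g).
Proof. by move=> I; apply/ffunP => k; rewrite !ffunE permKV. Qed.

Lemma icompKV s : cancel (icomp^~ s^-1%g) (icomp^~ s).
Proof. by move=> I; apply/ffunP => k; rewrite !ffunE permK. Qed.

Lemma icompM I s t : icomp I (s * t)%g = icomp (icomp I t) s.
Proof. by apply/ffunP => k; rewrite !ffunE permM. Qed.

Lemma sum_icomp s (G : T -> C) : \sum_I G (icomp I s) = \sum_I G I.
Proof.
rewrite [RHS](reindex (icomp^~ s)) //.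
by exists (icomp^~ s^-1%g) => I _; rewrite ?icompK ?icompKV.
Qed.

Definition permT (s : 'S_d) : 'M[C]_#|T| :=
  mxT (fun I J : T => (I == icomp J s)%:R).

Lemma ent_permTM s X I J : ent (permT s *m X) I J = ent X (icomp I s^-1%g) J.
Proof.
rewrite entM (bigD1 (icomp I s^-1%g)) //= entE icompKV eqxx mul1r big1 ?addr0 //.
move=> K ne; rewrite entE; case: eqP => [e|_]; last by rewrite mul0r.
by rewrite e icompK eqxx in ne.
Qed.

Lemma ent_mulmx_permT s X I J : ent (X *m permT s) I J = ent X I (icomp J s).
Proof.
rewrite entM (bigD1 (icomp J s)) //= entE eqxx mulr1 big1 ?addr0 //.
by move=> K /negPf ne; rewrite entE ne mulr0.
Qed.

Lemma permTM s t : permT (s * t)%g = permT s *m permT t.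
Proof.
apply: ent_inj => I J; rewrite ent_permTM !entE icompM.
by rewrite -[in LHS](icompKV s I) (inj_eq (can_inj (icompK s))).
Qed.

(** Membership in the commutant of S_d, in terms of entries; [symTP] recovers commutation. *)
Definition symT (X : 'M[C]_#|T|) : Prop :=
  forall s I J, ent X (icomp I s) (icomp J s) = ent X I J.

Lemma symTP X : symT X -> forall s, permT s *m X = X *m permT s.
Proof.
move=> sX s; apply: ent_inj => I J; rewrite ent_permTM ent_mulmx_permT.
by rewrite -(sX s (icomp I _)) icompKV.
Qed.

Lemma prod_icomp s (I J : T) (G : 'I_N -> 'I_N -> C) :
  \prod_k G (icomp I s k) (icomp J s k) = \prod_k G (I k) (J k).
Proof.
rewrite [RHS](reindex_inj (@perm_inj _ s)); apply: eq_bigr => k _.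
by rewrite !ffunE.
Qed.

Lemma symT_tens g : symT (tens g).
Proof. by move=> s I J; rewrite !entE (prod_icomp s I J g). Qed.

Lemma symT1 : symT 1%:M.
Proof. by rewrite -tens1; apply: symT_tens. Qed.

Lemma symTM X Y : symT X -> symT Y -> symT (X *m Y).
Proof.
move=> sX sY s I J; rewrite !entM -(sum_icomp s).
by apply: eq_bigr => K _; rewrite sX sY.
Qed.

Lemma symTZ c X : symT X -> symT (c *: X).
Proof. by move=> sX s I J; rewrite !entZ sX. Qed.

Lemma symTD X Y : symT X -> symT Y -> symT (X + Y).
Proof. by move=> sX sY s I J; rewrite !entD sX sY. Qed.

Lemma symT0 : symT 0.
Proof. by move=> s I J; rewrite /ent !mxE. Qed.

Lemma symT_sum (K : finType) (P : pred K) (X : K -> 'M[C]_#|T|) :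
  (forall k, P k -> symT (X k)) -> symT (\sum_(k | P k) X k).
Proof.
move=> sX; elim/big_ind: _ => //; [exact: symT0|exact: symTD].
Qed.

Lemma symT_conj X : symT X -> symT (X^T ^ Num.conj)%sesqui.
Proof.
move=> sX s I J; rewrite /ent !mxE.
by have := sX s J I; rewrite /ent => ->.
Qed.

End TensorPower.

(** * The commutant of the symmetric group *)

(** Ryser's formula for the permanent: inclusion-exclusion over the sets S containing the image of h
    leaves only surjective h, that is, permutations. It serves both as polarization of g^{(x)d} and
    to relate [mixed_det] to determinants. *)
Lemma ryser (F : comNzRingType) d (y : 'I_d -> 'I_d -> F) :
  \sum_(S : {set 'I_d}) (-1) ^+ #|~: S| * \prod_k \sum_(i in S) y i k
  = \sum_(s : 'S_d) \prod_k y (s k) k.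
Proof.
pose H := {ffun 'I_d -> 'I_d}.
transitivity (\sum_(h : H) (\prod_k y (h k) k) *
    \prod_i (1 - (i \notin codom h)%:R) : F).
  under [RHS]eq_bigr do rewrite bigA_distr mulr_sumr.
  rewrite exchange_big /=; apply: eq_bigr => S _.
  rewrite (bigA_distr_big (mem S) (fun k i => y i k)) mulr_sumr big_mkcond /=.
  apply: eq_bigr => h _.
  rewrite [X in _ = _ * X](bigID (mem S)) /=.
  rewrite [X in _ = _ * (X * _)]big1 => [|i ->//]; rewrite mul1r.
  case: ifPn => [/ffun_onP hS|hS].
    rewrite mulrC; congr (_ * _).
    rewrite (eq_bigr (fun=> -1)) => [|i iS].
      by rewrite prodr_const; congr (_ ^+ _); apply: eq_card => i; rewrite !inE.
    rewrite (negPf iS); case: codomP => // -[k ik].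
    by rewrite ik hS in iS.
  have [k hk] : exists k, h k \notin S.
    apply/existsP; rewrite -negb_forall; apply: contra hS => /forallP hS.
    by apply/ffun_onP.
  by rewrite [X in _ = _ * X](bigD1 (h k)) //= (negPf hk) codom_f oppr0 mul0r mulr0.
rewrite (bigID (fun h : H => injectiveb h)) /= addrC big1 => [|h nh].
  rewrite add0r (reindex (@pval _)) /=; last first.
    pose in_Sn := insubd (1%g : 'S_d).
    by exists in_Sn => /= f Uf; first apply: val_inj; apply: insubdK.
  apply: eq_big => [s|s _]; first by rewrite (valP s).
  rewrite [X in _ * X]big1 => [|i _].
    by rewrite mulr1; apply: eq_bigr => k _; rewrite pvalE.
  suff -> : i \in codom (pval s) by rewrite subr0.
  by apply/codomP; exists (s^-1%g i); rewrite pvalE permKV.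
have [i ni] : exists i, i \notin codom h.
  apply/existsP; rewrite -negb_forall; apply: contra nh => /forallP sh.
  rewrite /injectiveb /dinjectiveb; apply/card_uniqP.
  by rewrite size_map -cardE; apply: eq_card => i; rewrite sh.
by rewrite [X in _ * X](bigD1 i) //= ni subrr mul0r mulr0.
Qed.

Lemma diag_mx_unitary (C : numClosedFieldType) N (u : 'rV[C]_N) :
  (forall i, `|u 0 i| = 1) -> diag_mx u \is unitarymx.
Proof.
move=> u1; apply/unitarymxP/matrixP => i j; rewrite mul_diag_mx !mxE.
case: (eqVneq j i) => [->|ne]; last by rewrite rmorph0 mulr0.
by rewrite !mulr1n -normCK u1 expr1n.
Qed.

Section WeightProjectors.
Variables (C : numClosedFieldType) (d N : nat).
Local Notation T := {ffun 'I_d -> 'I_N}.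
Local Notation shape := {ffun 'I_N -> 'I_d.+1}.

(** The weight of the basis tensor e_I, unrelated to the contents of cells in [content_sum]. The
    default of [inord] is never reached, as the counts are at most d. *)
Definition content (I : T) : shape :=
  [ffun i => inord #|[pred k | I k == i]|].

Lemma contentE I i : (content I i : nat) = #|[pred k | I k == i]|.
Proof.
rewrite ffunE inordK // ltnS; apply: leq_trans (max_card _) _.
by rewrite card_ord.
Qed.

Lemma content_icomp (I : T) s : content (icomp I s) = content I.
Proof.
apply/ffunP => i; apply: ord_inj; rewrite !contentE.
rewrite -[RHS](card_imset _ (@perm_inj _ s^-1%g)).
apply: eq_card => k; rewrite !inE ffunE; apply/idP/imsetP.
  by move=> e; exists (s k); rewrite ?inE ?permK.
by case=> l; rewrite inE => e ->; rewrite permKV.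
Qed.

Lemma prod_content (x : 'I_N -> C) (I : T) :
  \prod_k x (I k) = \prod_i x i ^+ content I i.
Proof.
rewrite (partition_big I predT) //=; apply: eq_bigr => i _.
rewrite (eq_bigr (fun=> x i)) => [|k /eqP->//].
by rewrite prodr_const contentE.
Qed.

Lemma sum_content (I : T) : (\sum_i content I i = d)%N.
Proof.
under eq_bigr do rewrite contentE -sum1_card.
transitivity (\sum_(k < d) 1)%N; last by rewrite sum1_card card_ord.
by rewrite (partition_big I predT).
Qed.

Definition diagT (f : shape -> C) : 'M[C]_#|T| :=
  mxT (fun I J : T => if I == J then f (content J) else 0).

(** The projector of V^{(x)d} onto its weight space of weight [nu]. *)
Definition weightT (nu : shape) := diagT (fun mu => (mu == nu)%:R).

Lemma symT_diagT f : symT (diagT f).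
Proof.
by move=> s I J; rewrite !entE content_icomp (inj_eq (can_inj (icompK s))).
Qed.

Lemma diagT_weightT f : diagT f = \sum_nu f nu *: weightT nu.
Proof.
apply: ent_inj => I J; rewrite ent_sum entE.
under eq_bigr do rewrite entZ entE.
case: eqP => _; last by rewrite big1 // => nu _; rewrite mulr0.
rewrite (bigD1 (content J)) //= eqxx mulr1 big1 ?addr0 // => nu ne.
by rewrite eq_sym (negPf ne) mulr0.
Qed.

Lemma tens_diag_mx (x : 'rV[C]_N) :
  tens d (diag_mx x) = diagT (fun nu => \prod_i x 0 i ^+ nu i).
Proof.
apply: ent_inj => I J; rewrite !entE.
under eq_bigr do rewrite mxE mulrb.
case: eqP => [->|ne].
  by under eq_bigr do rewrite eqxx; rewrite (prod_content (x 0)).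
have [k] : exists k, I k != J k.
  apply/existsP; rewrite -negb_forall; apply/negP => /forallP h.
  by apply: ne; apply/ffunP => k; apply/eqP/h.
by rewrite (bigD1 k) //= => /negPf->; rewrite mul0r.
Qed.

Definition root_row m (z : C) (h : {ffun 'I_N -> 'I_m}) : 'rV[C]_N :=
  \row_i z ^+ h i.

Lemma root_row_norm m z h i : m.-primitive_root z -> `|@root_row m z h 0 i| = 1.
Proof. by move=> zm; rewrite mxE normrX (norm_prim_root zm) expr1n. Qed.

(** Fourier inversion on the m-torsion of the torus; m > d separates the exponents 0, ..., d. It
    writes a weight projector through unitary matrices only, hence makes it visible to a
    representation of U_N. *)
Lemma weightT_fourier m (z : C) nu : m.-primitive_root z -> (d < m)%N ->
  weightT nu = (m%:R ^+ N)^-1 *: \sum_(h : {ffun 'I_N -> 'I_m})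
     (\prod_i z ^- (h i * nu i)) *: tens d (diag_mx (root_row z h)).
Proof.
move=> zm dm; apply: ent_inj => I J; rewrite entZ ent_sum entE.
under eq_bigr do rewrite entZ tens_diag_mx entE.
case: eqP => [_|_]; last first.
  by rewrite big1 ?mulr0 // => h _; rewrite mulr0.
have lt_m (mu : shape) i : (mu i < m)%N.
  exact: leq_trans (ltn_ord _) dm.
rewrite (eq_bigr (fun h : {ffun 'I_N -> 'I_m} =>
    \prod_i (z ^+ (h i * content J i) / z ^+ (h i * nu i)))); last first.
  move=> h _; rewrite -big_split /=; apply: eq_bigr => i _.
  by rewrite mulrC mxE -exprM.
rewrite fourier_orthogonality //.
have -> : [forall i, (content J i : nat) == nu i] = (content J == nu).
  apply/forallP/eqP => [e|->//]; apply/ffunP => i; apply: val_inj.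
  by apply/eqP; apply: e.
case: eqP => _; last by rewrite mulr0.
by rewrite mulVf // expf_neq0 // pnatr_eq0 -lt0n; apply: leq_ltn_trans dm.
Qed.

(* The tens g, for g unitary, span the commutant of S_d: by polarization the
   commutant is spanned by the tens H with H Hermitian, and such an H is
   unitarily diagonalizable. *)
Section Span.
Variable U : {vspace 'M[C]_#|T|}.
Hypothesis U_tens : forall g, g \is unitarymx -> tens d g \in U.

Lemma tens_normal_in H : H \is normalmx -> tens d H \in U.
Proof.
move=> /orthomx_spectralP ->; set S := spectralmx H.
have uS : S \is unitarymx := spectral_unitarymx H.
(* The eigenvalues of H need not have modulus 1; passing through the weight projectors replaces them
   by roots of unity. *)
rewrite invmx_unitary // !tensM tens_diag_mx diagT_weightT.
have [z zm] := exists_prim_root_pow2 C d.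
have dm : (d < 2 ^ d.+1)%N by rewrite ltnW // ltn_expl.
rewrite mulmx_sumr mulmx_suml; apply: memv_suml => nu _.
rewrite -scalemxAr -scalemxAl memvZ // (weightT_fourier nu zm dm).
rewrite -scalemxAr -scalemxAl memvZ // mulmx_sumr mulmx_suml.
apply: memv_suml => h _; rewrite -scalemxAr -scalemxAl memvZ // -!tensM U_tens //.
by rewrite !mul_unitarymx ?trmxC_unitary // diag_mx_unitary // => i;
  rewrite root_row_norm.
Qed.

(** The full polarization of X |-> X^{(x)d}. *)
Definition symprod (X : 'I_d -> 'M[C]_N) : 'M[C]_#|T| :=
  mxT (fun I J : T => \sum_(s : 'S_d) \prod_k X (s k) (I k) (J k)).

Lemma symprod_hermitian_in (X : 'I_d -> 'M[C]_N) :
  (forall k, X k = ((X k)^T ^ Num.conj)%sesqui) -> symprod X \in U.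
Proof.
move=> hX.
have -> : symprod X =
    \sum_(S : {set 'I_d}) (-1) ^+ #|~: S| *: tens d (\sum_(i in S) X i).
  apply: ent_inj => I J; rewrite entE ent_sum.
  rewrite -(ryser (fun i k => X i (I k) (J k))); apply: eq_bigr => S _.
  rewrite entZ entE; congr (_ * _); apply: eq_bigr => k _.
  by rewrite summxE.
apply: memv_suml => S _; rewrite memvZ // tens_normal_in //.
apply: hermitian_normalmx; apply/is_hermitianmxP; rewrite expr0 scale1r.
by rewrite raddf_sum map_mx_sum; apply: eq_bigr.
Qed.

Lemma symprod_in (X : 'I_d -> 'M[C]_N) : symprod X \in U.
Proof.
(* X = H_true + i H_false with both parts Hermitian; multilinearity does the rest. *)
pose H k (b : bool) := if b then 2^-1 *: (X k + ((X k)^T ^ Num.conj)%sesqui)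
  else 2^-1 *: ('i *: (((X k)^T ^ Num.conj)%sesqui - X k)).
pose c (b : bool) : C := if b then 1 else 'i.
have HH k b : H k b = ((H k b)^T ^ Num.conj)%sesqui.
  apply/matrixP => i j; rewrite /H; case: b; rewrite !mxE.
    rewrite rmorphM rmorphD /= conjCK addrC; congr (_ * _).
    by rewrite fmorphV /= conjC_nat.
  rewrite !rmorphM rmorphB /= conjCK conjCi fmorphV /= conjC_nat.
  by rewrite mulNr -mulrN opprB.
have XE k i j : X k i j = \sum_b c b * H k b i j.
  rewrite big_bool /= /c /H !mxE mul1r.
  rewrite [X in _ + X]mulrCA [X in _ + _ * X]mulrA -expr2 sqrCi mulN1r opprB.
  rewrite -mulrDr addrACA subrr addr0 -mulr2n -[X in _ * X]mulr_natl mulrA.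
  by rewrite mulVf ?mul1r // pnatr_eq0.
have -> : symprod X = \sum_(f : {ffun 'I_d -> bool})
    (\prod_k c (f k)) *: symprod (fun k => H k (f k)).
  apply: ent_inj => I J; rewrite ent_sum entE.
  under [RHS]eq_bigr do rewrite entZ entE mulr_sumr.
  rewrite exchange_big /=; apply: eq_bigr => s _.
  under eq_bigr do rewrite XE.
  rewrite bigA_distr_bigA.
  rewrite (reindex (fun f : {ffun 'I_d -> bool} => [ffun k => f (s k)])) /=.
    apply: eq_bigr => f _.
    rewrite [X in _ = X * _](reindex_inj (@perm_inj _ s)) -big_split /=.
    by apply: eq_bigr => k _; rewrite ffunE.
  exists (fun f : {ffun 'I_d -> bool} => [ffun k => f (s^-1%g k)]) => f _;
    by apply/ffunP => k; rewrite !ffunE ?permK ?permKV.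
by apply: memv_suml => f _; rewrite memvZ // symprod_hermitian_in.
Qed.

Lemma symT_in X : symT X -> X \in U.
Proof.
move=> sX.
(* X equals its own average over S_d, and the average of a matrix unit of V^{(x)d} is a polarized
   product of matrix units of V. *)
suff -> : X = (d`!%:R)^-1 *: \sum_(I0 : T) \sum_(J0 : T)
    ent X I0 J0 *: symprod (fun k => delta_mx (I0 k) (J0 k)).
  by rewrite memvZ //; do 2![apply: memv_suml => ? _]; rewrite memvZ // symprod_in.
apply: ent_inj => I J; rewrite entZ ent_sum.
rewrite (eq_bigr (fun I0 : T => \sum_(J0 : T) \sum_(s : 'S_d)
    ent X I0 J0 * ((I == icomp I0 s)%:R * (J == icomp J0 s)%:R))); last first.
  move=> I0 _; rewrite ent_sum; apply: eq_bigr => J0 _.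
  rewrite entZ entE mulr_sumr; apply: eq_bigr => s _; congr (_ * _).
  rewrite -2!prodr_eqb -big_split; apply: eq_bigr => k _ /=.
  by rewrite !mxE !ffunE -natrM mulnb.
under eq_bigr do rewrite exchange_big.
rewrite exchange_big /= (eq_bigr (fun=> ent X I J)) => [|s _].
  by rewrite sumr_const card_Sn -[X in _ * X]mulr_natl mulrA mulVf ?mul1r
    ?pnatr_eq0 -?lt0n ?fact_gt0.
rewrite (bigD1 (icomp I s^-1%g)) //= (bigD1 (icomp J s^-1%g)) //=.
rewrite !icompKV !eqxx !mulr1 big1 ?addr0 => [|J0 ne].
  rewrite big1 ?addr0 => [|I0 ne].
    by rewrite -(sX s) !icompKV.
  rewrite big1 // => J0 _; case: eqP => [e|]; last by rewrite mul0r mulr0.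
  by rewrite e icompK eqxx in ne.
case: (J =P _) => [e|]; last by rewrite !mulr0.
by rewrite e icompK eqxx in ne.
Qed.

End Span.

Lemma symT_span X : symT X -> exists m (c : 'I_m -> C) (g : 'I_m -> 'M[C]_N),
  (forall i, g i \is unitarymx) /\ X = \sum_i c i *: tens d (g i).
Proof.
have [gs [_ gsP span]] :=
  spanning_family (fun g : 'M[C]_N => is_true (g \is unitarymx)) (@tens C d N).
move=> /(symT_in span).
have szn : size (map (@tens C d N) gs) == size gs by rewrite size_map.
move=> XU; have {}XU : X \in <<Tuple szn>>%VS by [].
exists (size gs), (fun i => coord (Tuple szn) i X), (fun i => gs`_i); split.
  by move=> i; apply/gsP/mem_nth.
rewrite {1}(coord_span XU); apply: eq_bigr => i _; congr (_ *: _).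
by rewrite (nth_map 0).
Qed.

End WeightProjectors.

(** * Symmetric polynomials in the eigenvalues *)

Section HomogeneousPolynomials.
Variables (C : numClosedFieldType) (N : nat).

(** Homogeneous polynomial functions of the entries, of degree n. The inductive form lets
    [hpoly_relation] peel off one entry, that is, one tensor factor, at a time. *)
Inductive hpoly : nat -> ('M[C]_N -> C) -> Prop :=
| hpoly_const c : hpoly 0 (fun=> c)
| hpoly_entry n f i j : hpoly n f -> hpoly n.+1 (fun g => g i j * f g)
| hpoly0 n : hpoly n (fun=> 0)
| hpolyD n f h : hpoly n f -> hpoly n h -> hpoly n (fun g => f g + h g)
| hpoly_ext n f h : f =1 h -> hpoly n f -> hpoly n h.

Lemma hpoly_sum (I : finType) (P : pred I) n (f : I -> 'M[C]_N -> C) :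
  (forall i, P i -> hpoly n (f i)) -> hpoly n (fun g => \sum_(i | P i) f i g).
Proof.
move=> hf; rewrite unlock /=; elim: (index_enum I) => [|i r IH] /=.
  exact: hpoly0.
by case Pi: (P i) => //; apply: hpolyD => //; apply: hf.
Qed.

Lemma hpolyM m n f h : hpoly m f -> hpoly n h ->
  hpoly (m + n) (fun g => f g * h g).
Proof.
move=> hf hh; elim: hf => {m f} [c|m f i j _ IH|m|m f1 f2 _ IH1 _ IH2|m f1 f2 e _ IH].
- elim: hh => {n h} [c'|n f i j _ IH|n|n f1 f2 _ IH1 _ IH2|n f1 f2 e _ IH].
  + exact: hpoly_const.
  + by apply: hpoly_ext (hpoly_entry i j IH) => g; rewrite mulrCA.
  + by apply: hpoly_ext (hpoly0 _) => g; rewrite mulr0.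
  + by apply: hpoly_ext (hpolyD IH1 IH2) => g; rewrite mulrDr.
  + by apply: hpoly_ext IH => g; rewrite e.
- by apply: hpoly_ext (hpoly_entry i j IH) => g; rewrite mulrA.
- by apply: hpoly_ext (hpoly0 _) => g; rewrite mul0r.
- by apply: hpoly_ext (hpolyD IH1 IH2) => g; rewrite mulrDl.
- by apply: hpoly_ext IH => g; rewrite e.
Qed.

Lemma hpolyZ n c f : hpoly n f -> hpoly n (fun g => c * f g).
Proof. exact: hpolyM (hpoly_const c). Qed.

Lemma hpoly_prod (I : finType) (n : I -> nat) (f : I -> 'M[C]_N -> C) :
  (forall i, hpoly (n i) (f i)) ->
  hpoly (\sum_i n i) (fun g => \prod_i f i g).
Proof.
move=> hf; rewrite unlock /=; elim: (index_enum I) => [|i r IH] /=.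
  exact: hpoly_const.
exact: hpolyM.
Qed.

Lemma hpoly_expmx n i j : hpoly n (fun g => (g ^+ n) i j).
Proof.
elim: n i j => [|n IH] i j.
  by apply: hpoly_ext (hpoly_const (i == j)%:R) => g; rewrite expr0 mxE.
apply: hpoly_ext (hpoly_sum (fun l (_ : xpredT l) => hpoly_entry i l (IH l j))) => g.
by rewrite exprS mxE.
Qed.

Lemma hpoly_relation d f : hpoly d f ->
  forall m (c : 'I_m -> C) (g : 'I_m -> 'M[C]_N),
  (forall I J : {ffun 'I_d -> 'I_N},
     \sum_i c i * \prod_k g i (I k) (J k) = 0) ->
  \sum_i c i * f (g i) = 0.
Proof.
elim=> {d f} [a|d f i j _ IH|d|d f1 f2 _ IH1 _ IH2|d f1 f2 e _ IH] m c g rel.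
- have empty : {ffun 'I_0 -> 'I_N} by apply: finfun => -[].
  have := rel empty empty.
  under eq_bigr do rewrite big_ord0 mulr1.
  by rewrite -mulr_suml => ->; rewrite mul0r.
- under eq_bigr do rewrite mulrA.
  (* The entry that is split off is absorbed into the coefficients, which is why the statement
     quantifies over [c] after the induction. *)
  apply: IH => I J.
  pose cons (a : 'I_N) (K : {ffun 'I_d -> 'I_N}) : {ffun 'I_d.+1 -> 'I_N} :=
    [ffun k => if unlift ord0 k is Some l then K l else a].
  rewrite -[RHS](rel (cons i I) (cons j J)); apply: eq_bigr => l _.
  rewrite big_ord_recl !ffunE unlift_none mulrA; congr (_ * _).
  by apply: eq_bigr => k _; rewrite !ffunE liftK.
- by rewrite big1 // => i _; rewrite mulr0.
- under eq_bigr do rewrite mulrDr.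
  by rewrite big_split /= IH1 // IH2 // addr0.
- by under eq_bigr do rewrite -e; apply: IH.
Qed.

Lemma hpoly_tens d f : hpoly d f ->
  exists L : {linear 'M[C]_#|{ffun 'I_d -> 'I_N}| -> C^o},
    forall g, L (tens d g) = f g.
Proof.
move=> hf.
have [|L LE] := @linear_extension C _ C^o _ (fun=> True) (@tens C d N) f.
  move=> m c g _ rel; apply: (hpoly_relation hf) => I J.
  have /(congr1 (fun X => ent X I J)) := rel.
  rewrite ent_sum {2}/ent mxE => E; rewrite -[RHS]E.
  by apply: eq_bigr => i _; rewrite entZ entE.
by exists L => g; apply: LE.
Qed.

(* Up to a multiple, the monomial symmetric polynomial m_nu. *)
Definition orbit_sum (nu : 'I_N -> nat) (x : 'I_N -> C) : C :=
  \sum_(s : 'S_N) \prod_j x j ^+ nu (s j).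

(* The coefficient of t_1 ... t_N in det (\sum_i t_i g ^ nu_i). *)
Definition mixed_det (nu : 'I_N -> nat) (g : 'M[C]_N) : C :=
  \sum_(t : 'S_N) (-1) ^+ t *
    \sum_(s : 'S_N) \prod_j (g ^+ nu (s j)) j (t j).

Lemma hpoly_mixed_det nu : hpoly (\sum_i nu i) (mixed_det nu).
Proof.
apply: hpoly_sum => t _; apply: hpolyZ; apply: hpoly_sum => s _.
rewrite (reindex_inj (@perm_inj _ s)) /=.
by apply: hpoly_prod => j; apply: hpoly_expmx.
Qed.

(** [ryser] turns both sides into signed sums over S, of determinants of \sum_(i in S) g^nu_i on the
    left; determinants are invariant under conjugation. So a symmetric function of the eigenvalues
    extends to a polynomial in the entries. *)
Lemma orbit_sum_mixed_det nu (P : 'M[C]_N) (x : 'rV[C]_N) : P \in unitmx ->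
  mixed_det nu (P *m diag_mx x *m invmx P) = orbit_sum nu (x 0).
Proof.
move=> uP; set g := _ *m invmx P.
have gX n : g ^+ n = P *m diag_mx (\row_j x 0 j ^+ n) *m invmx P.
  elim: n => [|n IH].
    rewrite expr0; under eq_mx do rewrite expr0.
    have -> : diag_mx (\row__ 1) = 1%:M :> 'M[C]_N.
      by rewrite -diag_const_mx; congr diag_mx; apply/rowP => j; rewrite !mxE.
    by rewrite mulmx1 mulmxV.
  rewrite exprS IH /g -!mulmxE !mulmxA mulmxKV //.
  congr (_ *m _); rewrite -!mulmxA; congr (_ *m _).
  by rewrite mulmx_diag; congr diag_mx; apply/rowP => j; rewrite !mxE exprS.
rewrite /orbit_sum -(ryser (fun i j => x 0 j ^+ nu i)).
transitivity (\sum_(S : {set 'I_N}) (-1) ^+ #|~: S| *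
    \det (\sum_(i in S) g ^+ nu i)).
  rewrite /mixed_det.
  under eq_bigr => t _ do
    rewrite -(ryser (fun i j => (g ^+ nu i) j (t j))) mulr_sumr.
  rewrite exchange_big /=; apply: eq_bigr => S _.
  rewrite mulr_sumr; apply: eq_bigr => t _; rewrite mulrCA; congr (_ * (_ * _)).
  by apply: eq_bigr => j _; rewrite summxE.
apply: eq_bigr => S _; congr (_ * _).
have -> : \sum_(i in S) g ^+ nu i =
    P *m diag_mx (\row_j \sum_(i in S) x 0 j ^+ nu i) *m invmx P.
  under eq_bigr do rewrite gX.
  rewrite -mulmx_suml -mulmx_sumr; congr (_ *m _ *m _).
  rewrite -raddf_sum; congr diag_mx; apply/rowP => j.
  by rewrite summxE !mxE; apply: eq_bigr => i _; rewrite mxE.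
rewrite !det_mulmx mulrAC -det_mulmx mulmxV // det1 mul1r det_diag.
by apply: eq_bigr => j _; rewrite mxE.
Qed.

End HomogeneousPolynomials.

(** * Weights of unitary representations *)

Section Dominance.
Variable N : nat.
Implicit Types mu lam : 'I_N -> int.

(** A root e_i - e_j with i < j adds 1 to the sum of the first p entries if i < p <= j, and 0
    otherwise. *)
Lemma weight_le_sum mu lam p : weight_le mu lam ->
  \sum_(k < N | (k < p)%N) mu k <= \sum_(k < N | (k < p)%N) lam k.
Proof.
case=> c e; rewrite -subr_ge0 -sumrB.
under eq_bigr do rewrite e.
rewrite sumrB [X in _ - X](exchange_big_dep (fun i : 'I_N => (i < p)%N)) /=; last first.
  by move=> k i kp ik; apply: ltn_trans kp.
rewrite -sumrB; apply: sumr_ge0 => i ip.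
rewrite (bigID (fun j : 'I_N => (j < p)%N)) /=.
rewrite (eq_bigl (fun j : 'I_N => (j < p)%N && (i < j)%N)); last first.
  by move=> j; rewrite andbC.
by rewrite addrAC subrr add0r sumr_ge0.
Qed.

Lemma weight_le_total mu lam : weight_le mu lam ->
  \sum_k mu k = \sum_k lam k.
Proof.
case=> c e; apply/eqP; rewrite eq_sym -subr_eq0 -sumrB.
under eq_bigr do rewrite e.
by rewrite sumrB (exchange_big_dep xpredT) //= subrr.
Qed.

Lemma eq_partial_sums mu lam :
  (forall p : nat, \sum_(k < N | (k < p)%N) mu k = \sum_(k < N | (k < p)%N) lam k) ->
  mu =1 lam.
Proof.
move=> e k; have := e k.+1.
have split (f : 'I_N -> int) :
    \sum_(i < N | (i < k.+1)%N) f i = f k + \sum_(i < N | (i < k)%N) f i.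
  rewrite (bigD1 k) //=; congr (_ + _); apply: eq_bigl => i.
  by rewrite ltnS [in RHS]ltn_neqAle andbC.
by rewrite !split e => /addIr.
Qed.

Lemma weight_le_anti mu lam : weight_le mu lam -> weight_le lam mu -> mu =1 lam.
Proof.
move=> h1 h2; apply: eq_partial_sums => p; apply/eqP.
by rewrite eq_le !weight_le_sum.
Qed.

End Dominance.

Section Shapes.
Variables (C : numClosedFieldType) (d N : nat).
Local Notation shape := {ffun 'I_N -> 'I_d.+1}.

Lemma young_sum (l : shape) : l \in young N d -> (\sum_i l i = d)%N.
Proof. by rewrite inE => /andP[_ /eqP]. Qed.

Lemma orbit_sum_perm (nu mu : 'I_N -> nat) (s : 'S_N) (x : 'I_N -> C) :
  (forall i, mu i = nu (s i)) -> orbit_sum mu x = orbit_sum nu x.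
Proof.
move=> e; rewrite /orbit_sum [RHS](reindex_inj (mulIg s)) /=.
by apply: eq_bigr => t _; apply: eq_bigr => j _; rewrite e permM.
Qed.

Lemma sort_shape (nu : shape) : (\sum_i nu i = d)%N ->
  exists2 l : shape, l \in young N d &
    forall x : 'I_N -> C, orbit_sum (fun i => l i) x = orbit_sum (fun i => nu i) x.
Proof.
move=> nud; pose t := [tuple nu i | i < N].
pose ge (a b : 'I_d.+1) := (b <= a)%N.
have st : size (sort ge t) == N by rewrite size_sort size_tuple.
have /tuple_permP[s ts] : perm_eq (Tuple st) t by rewrite perm_sort.
pose l : shape := [ffun i => nu (s i)].
have lE i : l i = tnth (Tuple st) i.
  rewrite ffunE; have -> : Tuple st = [tuple tnth t (s i) | i < N] by apply: val_inj.
  by rewrite !tnth_mktuple.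
exists l; last by move=> x; apply: (@orbit_sum_perm _ _ s) => i; rewrite ffunE.
rewrite inE; apply/andP; split.
  apply/forallP => i; apply/forallP => j; apply/implyP; rewrite leq_eqVlt.
  case/orP => [/eqP/val_inj->//|ij]; rewrite !lE.
  have tr : transitive ge by move=> y x z /= xy yz; apply: leq_trans yz xy.
  have tot : total ge by move=> x y; exact: leq_total.
  have := sort_sorted tot t; rewrite -/(tval (Tuple st)).
  rewrite (sorted_pairwise tr) => /(pairwiseP (nu i)) /(_ i j).
  by rewrite !inE size_sort size_tuple !ltn_ord => /(_ isT isT ij); rewrite -!tnth_nth.
apply/eqP; rewrite -[RHS]nud [RHS](reindex_inj (@perm_inj _ s)).
by apply: eq_bigr => i _; rewrite ffunE.
Qed.

(** Averaging over S_N replaces each monomial by the orbit sum of its sorted exponent. The domain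
    [D] will be the torus, the only place where the characters are known at first. *)
Lemma symmetric_orbit_sums (K : finType) (nu : K -> shape)
    (f : 'rV[C]_N -> C) (D : 'rV[C]_N -> Prop) :
  (forall k, \sum_i nu k i = d)%N ->
  (forall u, D u -> f u = \sum_k \prod_i u 0 i ^+ nu k i) ->
  (forall u (s : 'S_N), D u -> D (col_perm s u) /\ f (col_perm s u) = f u) ->
  exists A : shape -> C, forall u, D u ->
    f u = \sum_(l in young N d) A l * orbit_sum (fun i => l i) (u 0).
Proof.
move=> nud fE fs.
have /choice[l lP] : forall k, exists l : shape, l \in young N d /\
    forall x : 'I_N -> C, orbit_sum (fun i => l i) x = orbit_sum (fun i => nu k i) x.
  by move=> k; have [l] := sort_shape (nud k); exists l.
exists (fun m => (N`!%:R)^-1 * \sum_(k | l k == m) 1) => u Du.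
have n0 : (N`!%:R : C) != 0 by rewrite pnatr_eq0 -lt0n fact_gt0.
apply: (mulfI n0).
transitivity (\sum_(s : 'S_N) \sum_k \prod_i (col_perm s u) 0 i ^+ nu k i).
  rewrite mulr_natl -card_Sn -sumr_const; apply: eq_bigr => s _.
  by have [Ds <-] := fs u s Du; rewrite fE.
rewrite exchange_big /= mulr_sumr.
under [RHS]eq_bigr => m _ do rewrite mulrA mulrA divff // mul1r mulr_suml.
rewrite (partition_big l (mem (young N d))) /=; last by move=> k _; exact: (lP k).1.

apply: eq_bigr => m _; apply: eq_bigr => k /eqP <-; rewrite mul1r (lP k).2.
rewrite /orbit_sum [RHS](reindex_inj invg_inj); apply: eq_bigr => s _.
rewrite [RHS](reindex_inj (@perm_inj _ s)); apply: eq_bigr => i _.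
by rewrite mxE permK.
Qed.

End Shapes.

Lemma unitary_diagonalize (C : numClosedFieldType) N (g : 'M[C]_N) :
  g \is unitarymx -> exists (P : 'M[C]_N) (x : 'rV[C]_N),
    [/\ P \is unitarymx, forall i, `|x 0 i| = 1 & g = P *m diag_mx x *m invmx P].
Proof.
move=> ug; have /orthomx_spectralP : g \is normalmx.
  apply/normalmxP; rewrite (unitarymxP ug).
  by rewrite -invmx_unitary // mulVmx // unitarymx_unit.
set S := spectralmx g; set x := spectral_diag g => gE.
have uS : S \is unitarymx := spectral_unitarymx g.
have uSV : invmx S \is unitarymx by rewrite invmx_unitary // trmxC_unitary.
exists (invmx S), x; split => //; last by rewrite invmxK.
have : diag_mx x \is unitarymx.
  have -> : diag_mx x = S *m g *m invmx S.
    have uS' := unitarymx_unit uS.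
    by rewrite gE !mulmxA mulmxV // mul1mx -mulmxA mulmxV // mulmx1.
  by rewrite !mul_unitarymx.
move=> /unitarymxP/matrixP ux i; have := ux i i.
rewrite mul_diag_mx !mxE eqxx !mulr1n -normCK => /eqP.
by rewrite sqrp_eq1 // => /eqP.
Qed.

Lemma perm_mx_unitary (C : numClosedFieldType) N (s : 'S_N) :
  perm_mx s \is @unitarymx C N N.
Proof.
apply/unitarymxP; rewrite tr_perm_mx map_perm_mx -perm_mxM mulgV.
exact: perm_mx1.
Qed.

Lemma diag_mx_col_perm (F : pzSemiRingType) N (s : 'S_N) (u : 'rV[F]_N) :
  diag_mx (col_perm s u) = perm_mx s *m diag_mx u *m perm_mx s^-1.
Proof.
rewrite -row_permE -col_permE; apply/matrixP => i j; rewrite !mxE.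
by rewrite (inj_eq perm_inj).
Qed.

Section Weights.
Variables (C : numClosedFieldType) (N : nat) (rho : unitary_rep C N).
Local Notation n := (urep_dim rho).

Definition torus (u : 'rV[C]_N) := forall i, `|u 0 i| = 1.

Lemma torus_unitary u : torus u -> diag_mx u \is unitarymx.
Proof. exact: diag_mx_unitary. Qed.

Lemma torus_neq0 u i : torus u -> u 0 i != 0.
Proof. by move=> tu; rewrite -normr_eq0 tu oner_eq0. Qed.

Lemma torus_col_perm s u : torus u -> torus (col_perm s u).
Proof. by move=> tu i; rewrite mxE. Qed.

Lemma urepK P : P \is unitarymx -> rho P *m rho (invmx P) = 1%:M.
Proof.
move=> uP; have uPV : invmx P \is unitarymx.
  by rewrite invmx_unitary // trmxC_unitary.
by rewrite -urepM // mulmxV ?unitarymx_unit // urep1.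
Qed.

Lemma mxtrace_urep_conj P g : P \is unitarymx -> g \is unitarymx ->
  \tr (rho (P *m g *m invmx P)) = \tr (rho g).
Proof.
move=> uP ug; have uPV : invmx P \is unitarymx.
  by rewrite invmx_unitary // trmxC_unitary.
rewrite urepM ?mul_unitarymx // urepM // mxtrace_mulC mulmxA.
have := urepK uPV; rewrite invmxK => ->.
by rewrite mul1mx.
Qed.

(** Permutation matrices are unitary and normalize the torus, so they carry weight vectors to weight
    vectors. *)
Lemma is_weight_perm mu (s : 'S_N) :
  is_weight rho mu -> is_weight rho (fun i => mu (s i)).
Proof.
case=> v v0 hv; have uP := perm_mx_unitary C s.
exists (rho (perm_mx s) *m v).
  apply: contraNneq v0 => e; have uPV : invmx (perm_mx s) \is @unitarymx C N N.
    by rewrite invmx_unitary // trmxC_unitary.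
  rewrite -[v]mul1mx -(urepK uPV) invmxK -mulmxA e mulmx0 //.
move=> u tu; have tu' := torus_col_perm s^-1 tu.
rewrite mulmxA -urepM ?torus_unitary //.
have -> : diag_mx u *m perm_mx s = perm_mx s *m diag_mx (col_perm s^-1 u).
  rewrite diag_mx_col_perm invgK !mulmxA -perm_mxM mulgV perm_mx1 mul1mx //.
rewrite urepM ?torus_unitary // -mulmxA hv // -scalemxAr; congr (_ *: _).
rewrite (reindex_inj (@perm_inj _ s)) /=; apply: eq_bigr => i _.
by rewrite mxE permK.
Qed.

(** The character on the torus is a sum of weights with multiplicity. It stays a hypothesis while
    the field is a general [C]; [torus_char_urep] derives it from continuity over R[i]. *)
Definition torus_char := exists mu : 'I_n -> 'I_N -> int,
  (forall k, is_weight rho (mu k)) /\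
  forall u, torus u -> \tr (rho (diag_mx u)) = \sum_k \prod_i u 0 i ^ mu k i.

Section Degree.
Variables (d : nat) (l : {ffun 'I_N -> 'I_d.+1}).
Hypotheses (ly : l \in young N d) (hl : has_highest_weight rho (row_lengths l)).

Lemma weight_total mu : is_weight rho mu -> \sum_i mu i = d%:Z.
Proof.
move=> /(proj2 hl)/weight_le_total->.
by rewrite -[in RHS](young_sum ly) -(raddf_sum Posz).
Qed.

(** A transposition brings entry i to the last place. No positive root is positive there, so the
    last entry of a weight is at least that of the highest weight, a row length. *)
Lemma weight_ge0 mu i : is_weight rho mu -> 0 <= mu i.
Proof.
have jN : (N.-1 < N)%N by case: N i => [[]|].
move=> /(is_weight_perm (tperm i (Ordinal jN))) /(proj2 hl)[c /(_ (Ordinal jN))].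
rewrite tpermR /row_lengths [X in _ = X - _]big_pred0 => [|j]; last first.
  by apply/negbTE; rewrite -leqNgt -ltnS (ltn_predK jN).
rewrite sub0r => /eqP; rewrite subr_eq addrC -subr_eq opprK => /eqP <-.
by rewrite addr_ge0 // sumr_ge0.
Qed.

Lemma weight_shape mu : is_weight rho mu ->
  exists nu : {ffun 'I_N -> 'I_d.+1},
    (\sum_i nu i = d)%N /\ forall i, mu i = nu i.
Proof.
move=> hmu.
have muE i : mu i = `|mu i|%N by rewrite gez0_abs // weight_ge0.
have sumd : (\sum_i `|mu i| = d)%N.
  apply/eqP; rewrite -eqz_nat -(weight_total hmu) (raddf_sum Posz).
  by apply/eqP; apply: eq_bigr => i _; exact: (esym (muE i)).
have lt_d i : (`|mu i| < d.+1)%N.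
  by rewrite ltnS -sumd (bigD1 i) //= leq_addr.
exists [ffun i => Ordinal (lt_d i)]; split; last by move=> i; rewrite ffunE.
by rewrite -[RHS]sumd; apply: eq_bigr => i _; rewrite ffunE.
Qed.

Lemma mxtrace_urep_mixed_det : torus_char ->
  exists A : {ffun 'I_N -> 'I_d.+1} -> C, forall g, g \is unitarymx ->
    \tr (rho g) = \sum_(m in young N d) A m * mixed_det (fun i => m i) g.
Proof.
case=> mu [mu_wt trE].
have /choice[nu nuP] := fun k => weight_shape (mu_wt k).
have [||u s|A AE] := @symmetric_orbit_sums C d N _ nu
    (fun u => \tr (rho (diag_mx u))) torus.
- by move=> k; case: (nuP k).
- move=> u tu; rewrite trE //; apply: eq_bigr => k _; apply: eq_bigr => i _.
  by rewrite (nuP k).2.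
- move=> tu; split; first exact: torus_col_perm.
  rewrite diag_mx_col_perm.
  have -> : perm_mx s^-1 = invmx (perm_mx s) :> 'M[C]_N.
    by rewrite invmx_unitary ?perm_mx_unitary // tr_perm_mx map_perm_mx.
  by rewrite mxtrace_urep_conj ?perm_mx_unitary ?torus_unitary.
exists A => g ug; have [P [x [uP tx ->]]] := unitary_diagonalize ug.
rewrite mxtrace_urep_conj ?torus_unitary // AE //.
by apply: eq_bigr => m _; rewrite orbit_sum_mixed_det ?unitarymx_unit.
Qed.

End Degree.
End Weights.

(** The trace on V^{(x)d} lies in the same span as the characters of the [W l]; [joint_kernel] uses
    it to recover this trace from theirs. *)
Lemma mxtrace_tens_mixed_det (C : numClosedFieldType) d N :
  exists A : {ffun 'I_N -> 'I_d.+1} -> C, forall g, g \is unitarymx ->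
    \tr (tens d g) = \sum_(m in young N d) A m * mixed_det (fun i => m i) g.
Proof.
have trE (x : 'rV[C]_N) : \tr (tens d (diag_mx x)) =
    \sum_(I : {ffun 'I_d -> 'I_N}) \prod_i x 0 i ^+ content I i.
  rewrite tens_diag_mx mxtrace_ent; apply: eq_bigr => I _.
  by rewrite entE eqxx.
have conjE (P : 'M[C]_N) x : P \in unitmx ->
    \tr (tens d (P *m x *m invmx P)) = \tr (tens d x).
  move=> uP; rewrite !tensM mxtrace_mulC mulmxA -tensM mulVmx //.
  by rewrite tens1 mul1mx.
have [||u s tu|A AE] := @symmetric_orbit_sums C d N _ (@content d N)
    (fun u => \tr (tens d (diag_mx u))) (@torus C N).
- by move=> I; exact: sum_content.
- by move=> u _; rewrite trE.
- split; first exact: torus_col_perm.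
  rewrite diag_mx_col_perm.
  have -> : perm_mx s^-1 = invmx (perm_mx s) :> 'M[C]_N.
    by rewrite invmx_unitary ?perm_mx_unitary // tr_perm_mx map_perm_mx.
  by rewrite conjE // unitmx_perm.
exists A => g ug; have [P [x [uP tx ->]]] := unitary_diagonalize ug.
rewrite conjE ?unitarymx_unit // AE //.
by apply: eq_bigr => m _; rewrite orbit_sum_mixed_det ?unitarymx_unit.
Qed.

(** * Extension to the commutant *)

Lemma mixed_det_functional (C : numClosedFieldType) d N
    (A : {ffun 'I_N -> 'I_d.+1} -> C) :
  exists L : {linear 'M[C]_#|{ffun 'I_d -> 'I_N}| -> C^o}, forall g,
    L (tens d g) = \sum_(m in young N d) A m * mixed_det (fun i => m i) g.
Proof.
apply: hpoly_tens; apply: hpoly_sum => m my; apply: hpolyZ.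
by have := hpoly_mixed_det C (fun i => m i); rewrite (young_sum my).
Qed.

Section Extension.
Variables (C : numClosedFieldType) (N : nat) (rho : unitary_rep C N).
Local Notation n := (urep_dim rho).
Hypothesis irr : urep_irreducible rho.

Lemma urep_span (Y : 'M[C]_n) : exists m (c : 'I_m -> C) (g : 'I_m -> 'M[C]_N),
  (forall i, g i \is unitarymx) /\ Y = \sum_i c i *: rho (g i).
Proof.
have [gs [fr gsP span]] :=
  spanning_family (fun g : 'M[C]_N => is_true (g \is unitarymx)) rho.
have szn : size (map rho gs) == size gs by rewrite size_map.
have YU : Y \in <<Tuple szn>>%VS.
  have gsE (i : 'I_(size gs)) : (map rho gs)`_i = rho gs`_i by rewrite (nth_map 0).
  apply: burnside => [|A B|W invW].
  - by rewrite -(urep1 rho); apply: span; apply/unitarymxP;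
      rewrite trmx1 map_mx1 mulmx1.
  - move=> /(@coord_span _ _ _ (Tuple szn)) -> /(@coord_span _ _ _ (Tuple szn)) ->.
    rewrite mulmx_suml; apply: memv_suml => i _; rewrite mulmx_sumr.
    apply: memv_suml => j _; rewrite -scalemxAl -scalemxAr !memvZ // !gsE.
    by rewrite -urepM ?gsP ?mem_nth // span // mul_unitarymx ?gsP ?mem_nth.
  - by apply: irr.2 => A v uA; apply: invW; apply: span.
exists (size gs), (fun i => coord (Tuple szn) i Y), (fun i => gs`_i); split.
  by move=> i; apply/gsP/mem_nth.
rewrite {1}(coord_span YU); apply: eq_bigr => i _; congr (_ *: _).
by rewrite (nth_map 0).
Qed.

(* The character of rho is a linear function of tens g, so a linear relation
   among the tens g is orthogonal to all of End under the trace form. *)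
Lemma urep_extension d (L : {linear 'M[C]_#|{ffun 'I_d -> 'I_N}| -> C^o}) :
  (forall g, g \is unitarymx -> L (tens d g) = \tr (rho g)) ->
  exists Rh : {linear 'M[C]_#|{ffun 'I_d -> 'I_N}| -> 'M[C]_n},
    forall g, g \is unitarymx -> Rh (tens d g) = rho g.
Proof.
move=> LE; apply: linear_extension => m c g ug rel; set X := \sum_i _.
have trX h : h \is unitarymx -> \tr (X *m rho h) = 0.
  move=> uh; rewrite -(linear0 L) -(mul0mx _ (tens d h)) -rel /X !mulmx_suml.
  rewrite [RHS]linear_sum [LHS]raddf_sum; apply: eq_bigr => i _.
  rewrite -!scalemxAl /= mxtraceZ linearZ /= -urepM // -tensM LE //.
  by rewrite mul_unitarymx.
have trXY Y : \tr (X *m Y) = 0.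
  have [k [c' [h [uh ->]]]] := urep_span Y.
  rewrite mulmx_sumr raddf_sum big1 // => i _.
  by rewrite -scalemxAr /= mxtraceZ trX // mulr0.
apply/matrixP => i j; rewrite [RHS]mxE -(trXY (delta_mx j i)) mxtrace_mulC.
rewrite /mxtrace (bigD1 j) //= big1 => [|k kj].
  rewrite addr0 mxE (bigD1 i) //= mxE !eqxx mul1r big1 ?addr0 // => k ki.
  by rewrite mxE (negPf ki) andbF mul0r.
by rewrite mxE big1 // => a _; rewrite mxE (negPf kj) mul0r.
Qed.

Section Extended.
Variables (d : nat) (Rh : {linear 'M[C]_#|{ffun 'I_d -> 'I_N}| -> 'M[C]_n}).
Hypothesis RhE : forall g, g \is unitarymx -> Rh (tens d g) = rho g.
Local Notation shape := {ffun 'I_N -> 'I_d.+1}.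

Lemma ext1 : Rh 1%:M = 1%:M.
Proof.
rewrite -(tens1 C d N) RhE ?urep1 //.
by apply/unitarymxP; rewrite trmx1 map_mx1 mulmx1.
Qed.

Lemma extM X Y : symT X -> symT Y -> Rh (X *m Y) = Rh X *m Rh Y.
Proof.
move=> /symT_span[m [c [g [ug ->]]]] /symT_span[k [c' [h [uh ->]]]].
rewrite mulmx_suml !(linear_sum Rh) mulmx_suml; apply: eq_bigr => i _.
rewrite !mulmx_sumr (linear_sum Rh); apply: eq_bigr => j _.
have Z a x : Rh (a *: x) = a *: Rh x by rewrite linearZ.
by rewrite -scalemxAl -scalemxAr !Z -scalemxAl -scalemxAr -tensM !RhE ?mul_unitarymx // urepM.
Qed.

Lemma ext_onto Y : exists2 X, symT X & Rh X = Y.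
Proof.
have [m [c [g [ug ->]]]] := urep_span Y.
exists (\sum_i c i *: tens d (g i)).
  by apply: symT_sum => i _; apply/symTZ/symT_tens.
by rewrite linear_sum; apply: eq_bigr => i _; rewrite linearZ /= RhE.
Qed.

(** Simplicity of the matrix algebra: if x is a nonzero (i, j) entry of [Rh X], lifts of x^-1 E_ki
    and E_jk cut [Rh X] down to E_kk, and these add up to 1. *)
Lemma ext_ideal X : symT X -> Rh X != 0 -> exists (a b : 'I_n -> 'M[C]_#|_|),
  [/\ forall k, symT (a k), forall k, symT (b k) &
    Rh (\sum_k a k *m X *m b k) = 1%:M].
Proof.
move=> sX nz; have [i [j nzij]] : exists i j, Rh X i j != 0.
  apply: contrapT => h; move/eqP: nz; apply; apply/matrixP => i j.
  by rewrite mxE; apply/eqP/negPn/negP => e; apply: h; exists i, j.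
have /choice[a aP] : forall k, exists Z, symT Z /\
    Rh Z = (Rh X i j)^-1 *: delta_mx k i.
  by move=> k; have [Z sZ e] := ext_onto ((Rh X i j)^-1 *: delta_mx k i); exists Z.
have /choice[b bP] : forall k, exists Z, symT Z /\ Rh Z = delta_mx j k.
  by move=> k; have [Z sZ e] := ext_onto (delta_mx j k); exists Z.
exists a, b; split=> [k|k|]; first exact: (aP k).1; first exact: (bP k).1.
rewrite linear_sum; apply/matrixP => p q; rewrite summxE (bigD1 p) //=.
have E k : Rh (a k *m X *m b k) = delta_mx k k.
  have [[sa aE] [sb bE]] := (aP k, bP k).
  rewrite !extM ?aE ?bE //; last exact: symTM.
  rewrite -!scalemxAl; apply/matrixP => r s; rewrite !mxE.
  rewrite (bigD1 j) //= big1 => [|t tj]; last first.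
    by rewrite !mxE (negPf tj) mulr0.
  rewrite addr0 !mxE eqxx (bigD1 i) //= big1 => [|t ti]; last first.
    by rewrite !mxE (negPf ti) andbF mul0r.
  rewrite addr0 !mxE eqxx andbT; case: (r == k) => /=; last by rewrite !mul0r mulr0.
  by rewrite mul1r mulrA mulVf // mul1r.
rewrite E big1 => [|k kp]; last by rewrite E !mxE eq_sym (negPf kp).
by rewrite addr0 !mxE eqxx eq_sym.
Qed.

Lemma ext_diagT (l : shape) (v : 'cV[C]_n) (f : shape -> C) :
  (forall u, torus u -> rho (diag_mx u) *m v = (\prod_i u 0 i ^ row_lengths l i) *: v) ->
  Rh (diagT f) *m v = f l *: v.
Proof.
move=> hv.
have wE nu : Rh (weightT C nu) *m v = (l == nu)%:R *: v.
  have [z zm] := exists_prim_root_pow2 C d.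
  have dm : (d < 2 ^ d.+1)%N by rewrite ltnW // ltn_expl.
  rewrite (weightT_fourier nu zm dm) linearZ /= linear_sum -scalemxAl mulmx_suml.
  have trow (h : {ffun 'I_N -> 'I_(2 ^ d.+1)}) : torus (root_row z h).
    by move=> i; rewrite root_row_norm.
  under eq_bigr => h _ do rewrite linearZ /= RhE ?torus_unitary // -scalemxAl hv // scalerA.
  rewrite -scaler_suml scalerA; congr (_ *: _).
  have lt_m (mu : shape) i : (mu i < 2 ^ d.+1)%N by exact: leq_trans (ltn_ord _) dm.
  rewrite (eq_bigr (fun h : {ffun 'I_N -> 'I_(2 ^ d.+1)} =>
      \prod_i (z ^+ (h i * l i) / z ^+ (h i * nu i)))); last first.
    move=> h _; rewrite -big_split /=; apply: eq_bigr => i _.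
    by rewrite mulrC mxE /row_lengths -exprnP -exprM.
  rewrite fourier_orthogonality //.
  have -> : [forall i, (l i : nat) == nu i] = (l == nu).
    apply/forallP/eqP => [e|->//]; apply/ffunP => i; apply: val_inj.
    by apply/eqP; apply: e.
  case: eqP => _; last by rewrite mulr0.
  by rewrite mulVf // expf_neq0 // pnatr_eq0 -lt0n; apply: leq_ltn_trans dm.
rewrite diagT_weightT linear_sum mulmx_suml (bigD1 l) //= linearZ /= -scalemxAl.
rewrite wE eqxx scale1r big1 ?addr0 // => nu ne.
by rewrite linearZ /= -scalemxAl wE eq_sym (negPf ne) scale0r scaler0.
Qed.

(** A nonzero column of the image of the projector would be a vector of weight l. *)
Lemma ext_weightT_eq0 (l : shape) :
  ~ is_weight rho (row_lengths l) -> Rh (weightT C l) = 0.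
Proof.
move=> nw; apply/matrixP => i j; rewrite [RHS]mxE; apply/eqP/negPn/negP => nz.
apply: nw; exists (Rh (weightT C l) *m delta_mx j 0).
  apply: contraNneq nz => /matrixP/(_ i 0); rewrite -colE !mxE => -> //.
move=> u tu; rewrite mulmxA -RhE ?torus_unitary // -extM; first last.
- exact: symT_diagT.
- exact: symT_tens.
have -> : tens d (diag_mx u) *m weightT C l =
    (\prod_i u 0 i ^ row_lengths l i) *: weightT C l.
  apply: ent_inj => I J; rewrite tens_diag_mx entM entZ !entE.
  rewrite (bigD1 I) //= !entE eqxx [X in _ + X]big1 ?addr0 => [|K]; last first.
    by rewrite !entE eq_sym => /negPf ->; rewrite mul0r.
  case: (I =P J) => [->|_]; last by rewrite !mulr0.
  by case: eqP => [->|_]; rewrite ?mulr0.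
by rewrite linearZ -scalemxAl.
Qed.

End Extended.
End Extension.

(** * The action of the class of transpositions *)

Lemma sum_transpositions (V : nmodType) d (f : 'S_d -> V) :
  (\sum_(s in transpositions d) f s) *+ 2 =
  \sum_(p : 'I_d * 'I_d | p.1 != p.2) f (tperm p.1 p.2).
Proof.
pose A := [set p : 'I_d * 'I_d | p.1 != p.2]%SET.
rewrite (eq_bigl (mem A)) => [|p]; last by rewrite !inE.
rewrite (partition_big_imset (fun p => tperm p.1 p.2)) /= -sumrMnl.
have -> : (fun p : 'I_d * 'I_d => tperm p.1 p.2) @: A = transpositions d.
  by apply/setP => s; apply/imsetP/imsetP => -[p pA ->]; exists p => //;
    move: pA; rewrite !inE.
apply: eq_bigr => s /imsetP[[a b]]; rewrite inE /= => ab ->.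
rewrite (eq_bigr (fun=> f (tperm a b))) => [|p /andP[_ /eqP->//]].
rewrite sumr_const; congr (_ *+ _).
rewrite (@eq_card _ _ (mem [set (a, b); (b, a)]%SET)) => [|[k l]].
  by rewrite cards2 xpair_eqE (negPf ab).
rewrite [LHS]unfold_in /= !inE /= !xpair_eqE; apply/idP/idP.
  case/andP => kl /eqP e; have lE : l = tperm a b k by rewrite -e tpermL.
  move: kl; rewrite lE; case: tpermP => [->|->|_ _]; rewrite ?eqxx ?orbT //=.
by case/orP => /andP[/eqP-> /eqP->]; rewrite ?ab ?eqxx // eq_sym ab tpermC eqxx.
Qed.

Section Casimir.
Variables (C : numClosedFieldType) (d N : nat).
Local Notation T := {ffun 'I_d -> 'I_N}.
Local Notation shape := {ffun 'I_N -> 'I_d.+1}.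

Definition class_sum : 'M[C]_#|T| := \sum_(s in transpositions d) permT C N s.

Definition upd (J : T) k i : T := [ffun k' => if k' == k then i else J k'].

(* The action of the matrix unit E_ij of gl_N by derivations. *)
Definition raiseT (i j : 'I_N) : 'M[C]_#|T| :=
  mxT (fun I J : T => \sum_k ((J k == j) && (I == upd J k i))%:R).

(* The sum of the contents (column minus row) of the cells of nu; the rows are
   numbered from 0. *)
Definition content_sum (nu : shape) : C :=
  \sum_i ((nu i)%:R * ((nu i)%:R - 1) / 2%:R - i%:R * (nu i)%:R).

Lemma upd_icomp J s k i : upd (icomp J s) k i = icomp (upd J (s k) i) s.
Proof. by apply/ffunP => l; rewrite !ffunE (inj_eq perm_inj). Qed.

Lemma symT_raiseT i j : symT (raiseT i j).
Proof.
move=> s I J; rewrite !entE [RHS](reindex_inj (@perm_inj _ s)).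
apply: eq_bigr => k _; rewrite upd_icomp (inj_eq (can_inj (icompK s))).
by rewrite ffunE.
Qed.

Lemma tens_raiseT (u : 'rV[C]_N) i j : u 0 j != 0 ->
  tens d (diag_mx u) *m raiseT i j =
  (u 0 i / u 0 j) *: (raiseT i j *m tens d (diag_mx u)).
Proof.
move=> uj; have diagE I J : ent (tens d (diag_mx u)) I J =
    if I == J then \prod_k u 0 (I k) else 0.
  rewrite tens_diag_mx entE; case: eqP => // ->.
  by rewrite (prod_content (u 0)).
apply: ent_inj => I J; rewrite entZ !entM (bigD1 I) //= big1 => [|K KI]; last first.
  by rewrite diagE eq_sym (negPf KI) mul0r.
rewrite [in RHS](bigD1 J) //= [X in _ = _ * (_ + X)]big1 => [|K KJ]; last first.
  by rewrite diagE (negPf KJ) mulr0.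
rewrite !addr0 !diagE !eqxx !entE mulr_sumr mulr_suml mulr_sumr.
apply: eq_bigr => k _; case: andP => [[/eqP Jk /eqP->]|_]; last first.
  by rewrite mul0r !mulr0.
rewrite mulr1 mul1r (bigD1 k) //= [in RHS](bigD1 k) //= ffunE eqxx Jk.
rewrite mulrA divfK //; congr (_ * _); apply: eq_bigr => l /negPf lk.
by rewrite ffunE lk.
Qed.

Lemma sum_content_index (J : T) (F : 'I_N -> C) :
  \sum_k F (J k) = \sum_i F i * (content J i)%:R.
Proof.
rewrite (partition_big J predT) //=; apply: eq_bigr => i _.
rewrite (eq_bigr (fun=> F i)) => [|k /eqP->//].
by rewrite sumr_const contentE mulr_natr.
Qed.

(* Since raiseT i j with i < j kills the highest weight vectors, class_sum acts
   on them by the content. *)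
Lemma class_sum_raiseT : class_sum = diagT content_sum +
  \sum_(j < N) \sum_(i < N | (i < j)%N) raiseT j i *m raiseT i j.
Proof.
apply: ent_inj => I J.
(* The sum of [phi] over ordered pairs of places is split by comparing [J k] with [J l]: ties give
   the diagonal part, and the two strict orders contribute equally. *)
pose phi k l : C := (I == icomp J (tperm k l))%:R.
pose delta : C := (I == J)%:R.
have phiC k l : phi k l = phi l k by rewrite /phi tpermC.
have phikk k : phi k k = delta.
  rewrite /phi tperm1; congr ((_ == _)%:R); apply/ffunP => i.
  by rewrite ffunE perm1.
have phi_eq k l : J k = J l -> phi k l = delta.
  move=> e; congr ((_ == _)%:R); apply/ffunP => i; rewrite ffunE.
  by case: tpermP => // ->.
have two0 : (2%:R : C) != 0 by rewrite pnatr_eq0.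
have lhs : 2%:R * ent class_sum I J = \sum_k \sum_l phi k l - d%:R * delta.
  rewrite ent_sum mulr_natl.
  under eq_bigr do rewrite entE.
  rewrite sum_transpositions pair_big /=.
  rewrite [in RHS](bigID (fun p : 'I_d * 'I_d => p.1 == p.2)) /=.
  rewrite [X in _ = X + _ - _](_ : _ = d%:R * delta); last first.
    rewrite -(pair_big_dep predT (fun k l => k == l) phi) /=.
    rewrite (eq_bigr (fun=> delta)) => [|k _].
      by rewrite sumr_const card_ord mulr_natl.
    by rewrite (bigD1 k) //= big1 ?addr0 // => l /andP[/eqP->]; rewrite eqxx.
  by rewrite addrAC subrr add0r.
have lower : ent (\sum_(j < N) \sum_(i < N | (i < j)%N) raiseT j i *m raiseT i j) I J
    = (\sum_l (J l)%:R) * delta + \sum_l \sum_(k | (J k < J l)%N) phi k l.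
  (* Lowering acts either at the place just raised, which restores J, or at another place k, which
     swaps k and l. The first case occurs [J l] times for each l and matches the row term of
     [content_sum]. *)
  pose G l i : C := delta + \sum_(k | k != l) (J k == i)%:R * phi k l.
  have rr i j : ent (raiseT j i *m raiseT i j) I J =
      \sum_l (J l == j)%:R * G l i.
    rewrite entM.
    under eq_bigr do rewrite !entE mulr_sumr.
    rewrite exchange_big /=; apply: eq_bigr => l _.
    rewrite (bigD1 (upd J l i)) //= eqxx andbT [X in _ + X = _]big1 => [|K KJ]; last first.
      by rewrite (negPf KJ) andbF mulr0.
    rewrite addr0 mulrC; case: eqP => [Jl|_]; last by rewrite !mul0r.
    rewrite !mul1r (bigD1 l) //= ffunE !eqxx /=; congr (_ + _).
      congr ((_ == _)%:R); apply/ffunP => k; rewrite !ffunE.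
      by case: eqP => // ->.
    apply: eq_bigr => k kl; rewrite ffunE (negPf kl) -mulnb natrM.
    case: eqP => [Jk|_]; last by rewrite !mul0r.
    congr (_ * (_ == _)%:R); apply/ffunP => a; rewrite !ffunE.
    case: tpermP => [->|->|/eqP/negPf-> /eqP/negPf->] //; first by rewrite eqxx Jl.
    by rewrite eq_sym (negPf kl) eqxx Jk.
  rewrite ent_sum.
  under eq_bigr => j _.
    rewrite ent_sum.
    under eq_bigr => i _ do rewrite rr.
    rewrite exchange_big /=.
    under eq_bigr => l _ do rewrite -mulr_sumr.
    over.
  rewrite exchange_big /= mulr_suml -big_split; apply: eq_bigr => l _ /=.
  rewrite (bigD1 (J l)) //= eqxx mul1r [X in _ + X]big1 => [|j /negPf jl]; last first.
    by rewrite eq_sym jl mul0r.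
  rewrite addr0 big_split /=; congr (_ + _).
    rewrite -(big_ord_widen N (fun=> delta)) ?sumr_const ?card_ord ?mulr_natl //.
    exact: ltnW.
  rewrite exchange_big /= [RHS](eq_bigl (fun k => (k != l) && (J k < J l)%N)).
    rewrite big_mkcondr; apply: eq_bigr => k kl; case: ifP => Jkl.
      rewrite (bigD1 (J k)) //= eqxx mul1r big1 ?addr0 // => i /andP[_ /negPf ik].
      by rewrite eq_sym ik mul0r.
    rewrite big1 // => i il; case: eqP => [e|]; last by rewrite mul0r.
    by rewrite e il in Jkl.
  move=> k; case: eqP => [->|//]; by rewrite ltnn.
have diag : 2%:R * ent (diagT content_sum) I J =
    \sum_l \sum_(k | J k == J l) phi k l - d%:R * delta
    - 2%:R * ((\sum_l (J l)%:R) * delta).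
  have -> : ent (diagT content_sum) I J = content_sum (content J) * delta.
    by rewrite entE /delta; case: eqP => _; rewrite ?mulr1 ?mulr0.
  have -> : \sum_l \sum_(k | J k == J l) phi k l =
      (\sum_i (content J i)%:R * (content J i)%:R) * delta.
    rewrite -(sum_content_index J (fun i => (content J i)%:R)) mulr_suml.
    apply: eq_bigr => l _; rewrite (eq_bigr (fun=> delta)) => [|k /eqP/phi_eq//].
    by rewrite sumr_const contentE mulr_natl.
  rewrite (sum_content_index J (fun i => i%:R)) !mulrA -!mulrBl; congr (_ * _).
  rewrite -[in d%:R](sum_content J) natr_sum !mulr_sumr -!sumrB.
  apply: eq_bigr => i _; rewrite mulrBr mulrCA mulfV // mulr1.
  by rewrite mulrBr mulr1.
have upper : \sum_l \sum_(k | (J l < J k)%N) phi k l =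
    \sum_l \sum_(k | (J k < J l)%N) phi k l.
  rewrite (exchange_big_dep xpredT) //=; apply: eq_bigr => k _.
  by apply: eq_bigr => l _; rewrite phiC.
have total : \sum_k \sum_l phi k l = \sum_l \sum_(k | J k == J l) phi k l +
    2%:R * \sum_l \sum_(k | (J k < J l)%N) phi k l.
  rewrite mulr_natl mulr2n -{1}upper -!big_split /= exchange_big /=.
  apply: eq_bigr => l _; rewrite (bigID (fun k => J k == J l)) /=; congr (_ + _).
  rewrite (bigID (fun k => J l < J k)%N) /=; congr (_ + _); apply: eq_bigl => k.
    by rewrite neq_ltn; case: ltngtP.
  by rewrite -val_eqE /=; case: ltngtP.
apply: (mulfI two0); rewrite lhs entD mulrDr lower diag total mulrDr addrA subrK.
by rewrite addrAC.
Qed.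

Lemma symT_class_sum : symT class_sum.
Proof.
rewrite class_sum_raiseT; apply: symTD; first exact: symT_diagT.
by do 2![apply: symT_sum => ? _]; apply: symTM; apply: symT_raiseT.
Qed.

Variables (rho : unitary_rep C N) (l : shape).
Variable Rh : {linear 'M[C]_#|T| -> 'M[C]_(urep_dim rho)}.
Hypotheses (irr : urep_irreducible rho) (hl : has_highest_weight rho (row_lengths l)).
Hypothesis RhE : forall g, g \is unitarymx -> Rh (tens d g) = rho g.

(** A nonzero image would have weight l + e_i - e_j, whose sum of entries up to i exceeds that of
    l. *)
Lemma ext_raiseT (v : 'cV[C]_(urep_dim rho)) (i j : 'I_N) : (i < j)%N ->
  (forall u, torus u -> rho (diag_mx u) *m v = (\prod_i u 0 i ^ row_lengths l i) *: v) ->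
  Rh (raiseT i j) *m v = 0.
Proof.
move=> ij hv; apply/eqP/negPn/negP => nz.
pose mu k := row_lengths l k + (k == i)%:Z - (k == j)%:Z.
have /(proj2 hl) : is_weight rho mu.
  exists (Rh (raiseT i j) *m v) => // u tu.
  have u0 k : u 0 k != 0 by exact: torus_neq0.
  have um := torus_unitary tu.
  rewrite mulmxA -RhE // -(extM RhE) ?tens_raiseT //; first last.
  - exact: symT_raiseT.
  - exact: symT_tens.
  rewrite linearZ /= (extM RhE) ?RhE //; first last.
  - exact: symT_tens.
  - exact: symT_raiseT.
  rewrite -scalemxAl -mulmxA hv // -scalemxAr scalerA; congr (_ *: _).
  rewrite /mu; under [RHS]eq_bigr do rewrite !expfzDr // mulrAC.
  rewrite !big_split /= mulrC -mulrA; congr (_ * _).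
  rewrite mulrC (bigD1 j) //= big1 => [|k /negPf ->]; last by rewrite oppr0 expr0z.
  rewrite [X in _ = _ * X](bigD1 i) //=.
  rewrite [X in _ = _ * (_ * X)]big1 => [|k /negPf ->]; last by rewrite expr0z.
  by rewrite !eqxx !mulr1 expr1z mulrC.
move=> /(weight_le_sum i.+1); apply/negP; rewrite -ltNge.
rewrite /mu sumrB big_split /= ltrBrDr ltrD2l.
rewrite [X in _ < X](_ : _ = 1); last first.
  rewrite (bigD1 i) //= eqxx big1 ?addr0 // => k /andP[_ /negPf ->] //.
rewrite big1 // => k; rewrite ltnS => ki; case: eqP => // e.
by move: ki; rewrite e leqNgt ij.
Qed.

(** Schur's argument: the eigenspace containing the highest weight vector is invariant, since
    [class_sum] commutes with every [tens d g]. *)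
Lemma ext_class_sum : Rh class_sum = (content_sum l)%:M.
Proof.
have [v v0 hv] := hl.1.
have Ev : Rh class_sum *m v = content_sum l *: v.
  rewrite class_sum_raiseT linearD mulmxDl /= (ext_diagT RhE _ hv).
  rewrite linear_sum mulmx_suml big1 ?addr0 // => j _.
  rewrite linear_sum mulmx_suml big1 // => i ij.
  rewrite (extM RhE) -?mulmxA; try exact: symT_raiseT.
  by rewrite (ext_raiseT ij hv) mulmx0.
pose f (w : 'cV[C]_(urep_dim rho)) := Rh class_sum *m w - content_sum l *: w.
have flin : linear f.
  move=> a x y; rewrite /f mulmxDr scalerDr -scalemxAr opprD addrACA scalerBr.
  by rewrite !scalerA mulrC.
pose LL := GRing.isLinear.Build _ _ _ _ f flin.
pose f' : {linear 'cV[C]_(urep_dim rho) -> 'cV[C]_(urep_dim rho)} := HB.pack f LL.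
have kerE w : (w \in lker (linfun f')) = (Rh class_sum *m w == content_sum l *: w).
  by rewrite memv_ker lfunE /= subr_eq0.
have [A w uA|ker0|kerT] := irr.2 (lker (linfun f')).
- rewrite !kerE => /eqP E; rewrite mulmxA -RhE // -(extM RhE); first last.
  + exact: symT_tens.
  + exact: symT_class_sum.
  have -> : class_sum *m tens d A = tens d A *m class_sum.
    rewrite mulmx_suml mulmx_sumr; apply: eq_bigr => s _.
    by apply: symTP; apply: symT_tens.
  rewrite (extM RhE) -?mulmxA ?E -?scalemxAr //; first exact: symT_tens.
  exact: symT_class_sum.
- have : v \in lker (linfun f') by rewrite kerE Ev.
  by rewrite ker0 memv0 (negPf v0).
apply/matrixP => i j; have : delta_mx j 0 \in lker (linfun f') by rewrite kerT memvf.
rewrite kerE => /eqP/matrixP/(_ i 0); rewrite -colE !mxE => ->.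
by rewrite eqxx andbT mulr_natr.
Qed.

End Casimir.

(** * The commutant as a sum of matrix algebras *)

Section Completeness.
Variables (C : numClosedFieldType) (d N : nat).
Local Notation T := {ffun 'I_d -> 'I_N}.
Local Notation shape := {ffun 'I_N -> 'I_d.+1}.
Variable W : shape -> unitary_rep C N.
Local Notation n l := (urep_dim (W l)).
Hypothesis irr : forall l, l \in young N d -> urep_irreducible (W l).
Hypothesis hw :
  forall l, l \in young N d -> has_highest_weight (W l) (row_lengths l).
Variable Rh : forall l, {linear 'M[C]_#|T| -> 'M[C]_(n l)}.
Hypothesis RhE : forall l, l \in young N d ->
  forall g, g \is unitarymx -> Rh l (tens d g) = W l g.

Lemma row_lengths_inj (l m : shape) : row_lengths l =1 row_lengths m -> l = m.
Proof.
by move=> e; apply/ffunP => i; apply: val_inj; have [] := e i.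
Qed.

(** The projector of weight l acts nontrivially on [W l] and by zero on [W m], of which l is not a
    weight; [ext_ideal] turns its image in [W l] into the identity. *)
Lemma separate_not_le l m : l \in young N d -> m \in young N d ->
  ~ weight_le (row_lengths l) (row_lengths m) ->
  exists2 X, symT X & Rh l X = 1%:M /\ Rh m X = 0.
Proof.
move=> ly my nle; have sw : symT (weightT C l) by exact: symT_diagT.
have nz : Rh l (weightT C l) != 0.
  have [v v0 hv] := (hw ly).1; apply: contraNneq v0 => e.
  by have := ext_diagT (RhE ly) (fun mu => (mu == l)%:R) hv;
    rewrite e mul0mx eqxx scale1r => <-.
have z : Rh m (weightT C l) = 0.
  apply: (ext_weightT_eq0 (RhE my)) => lw; apply: nle; exact: (hw my).2.
have [a [b [sa sb e]]] := ext_ideal (irr ly) (RhE ly) sw nz.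
exists (\sum_k a k *m weightT C l *m b k).
  by apply: symT_sum => k _; apply: symTM => //; apply: symTM.
split=> //; rewrite linear_sum big1 // => k _.
by rewrite !(extM (RhE my)) ?z ?mulmx0 ?mul0mx //; apply: symTM.
Qed.

(** By antisymmetry dominance fails in one direction; if it is the wrong one, 1 - X is used instead
    of X. *)
Lemma separate l m : l \in young N d -> m \in young N d -> l != m ->
  exists2 X, symT X & Rh l X = 1%:M /\ Rh m X = 0.
Proof.
move=> ly my lm.
have [lem|/separate_not_le] := pselect (weight_le (row_lengths l) (row_lengths m)); last exact.
have [mel|/separate_not_le] := pselect (weight_le (row_lengths m) (row_lengths l)).
  by move/eqP: lm; case; apply/row_lengths_inj/weight_le_anti.
move=> /(_ my ly)[X sX [Xm Xl]]; exists (1%:M - X).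
  by rewrite -scaleN1r; apply: symTD; [exact: symT1|exact: symTZ].
by rewrite !linearB /= Xm Xl !(ext1 (RhE _)) // subr0 subrr.
Qed.

Lemma block_unit l : l \in young N d -> exists2 X, symT X &
  Rh l X = 1%:M /\ forall m, m \in young N d -> m != l -> Rh m X = 0.
Proof.
move=> ly; suff H (s : seq shape) : {subset s <= young N d} ->
    exists2 X, symT X & Rh l X = 1%:M /\ forall m, m \in s -> m != l -> Rh m X = 0.
  have [|X sX [X1 X0]] := H (enum (young N d)); first by move=> m; rewrite mem_enum.
  by exists X => //; split=> // m my; apply: X0; rewrite mem_enum.
elim: s => [_|m s IH ssub]; first by exists 1%:M; [exact: symT1|rewrite (ext1 (RhE ly))].
have [|X sX [X1 X0]] := IH; first by move=> k ks; apply: ssub; rewrite inE ks orbT.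
have my : m \in young N d by apply: ssub; rewrite mem_head.
have [->|ml] := eqVneq m l.
  exists X => //; split=> // k; rewrite inE => /orP[/eqP->|/X0//].
  by rewrite eqxx.
have [|Y sY [Y1 Y0]] := separate ly my; first by rewrite eq_sym.
exists (X *m Y); first exact: symTM.
split=> [|k]; first by rewrite (extM (RhE ly)) // X1 Y1 mul1mx.
rewrite inE => /orP[/eqP->|ks] kl; first by rewrite (extM (RhE my)) // Y0 mulmx0.
have ky : k \in young N d by apply: ssub; rewrite inE ks orbT.
by rewrite (extM (RhE ky)) // X0 // mul0mx.
Qed.

(** Membership of l is put under the existential so that a choice can be made for all l at once. *)
Lemma matrix_unit l (p q : 'I_(n l)) : exists X, l \in young N d ->
  [/\ symT X, Rh l X = delta_mx p q &
    forall m, m \in young N d -> m != l -> Rh m X = 0].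
Proof.
have [ly|nly] := boolP (l \in young N d); last by exists 0.
have [X sX [X1 X0]] := block_unit ly.
have [Y sY YE] := ext_onto (irr ly) (RhE ly) (delta_mx p q).
exists (X *m Y) => _; split; first exact: symTM.
  by rewrite (extM (RhE ly)) // X1 YE mul1mx.
by move=> m my ml; rewrite (extM (RhE my)) // X0 // mul0mx.
Qed.

Hypothesis tch : forall l, l \in young N d -> torus_char (W l).

(* The characters of the W l are |young| independent functions in the span of
   the orbit sums, hence span it; so X in the kernel has trace 0 against the
   whole commutant. *)
Lemma joint_kernel X : symT X ->
  (forall l, l \in young N d -> Rh l X = 0) -> X = 0.
Proof.
have /choice[L LE] : forall m : shape,
    exists L : {linear 'M[C]_#|T| -> C^o}, m \in young N d ->
    forall g, L (tens d g) = mixed_det (fun i => m i) g.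
  move=> m; have [my|nmy] := boolP (m \in young N d).
    have := hpoly_mixed_det C (fun i => m i).
    by rewrite (young_sum my) => /hpoly_tens[L LE]; exists L.
  have [L _] := mixed_det_functional (fun _ : shape => 0 : C).
  by exists L.
have /choice[A AE] : forall l : shape, exists A : shape -> C, l \in young N d ->
    forall g, g \is unitarymx ->
    \tr (W l g) = \sum_(m in young N d) A m * mixed_det (fun i => m i) g.
  move=> l; have [ly|nly] := boolP (l \in young N d); last by exists (fun=> 0).
  have [A AE] := mxtrace_urep_mixed_det ly (hw ly) (tch ly).
  by exists A.
have LL m g c : L m (c *: g) = c * L m g by rewrite linearZ.
have AL l Y : l \in young N d -> symT Y ->
    \tr (Rh l Y) = \sum_(m in young N d) A l m * L m Y.
  move=> ly /symT_span[k [c [g [ug ->]]]].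
  rewrite (linear_sum (Rh l)) (raddf_sum (@mxtrace C _)).
  under [RHS]eq_bigr => m my do rewrite linear_sum mulr_sumr /=.
  rewrite [RHS]exchange_big /=; apply: eq_bigr => i _.
  rewrite linearZ /= mxtraceZ RhE // AE // mulr_sumr; apply: eq_bigr => m my.
  by rewrite LL LE // mulrCA.
have [B BE] := mxtrace_tens_mixed_det C d N.
have BL Y : symT Y -> \tr Y = \sum_(m in young N d) B m * L m Y.
  move=> /symT_span[k [c [g [ug ->]]]].
  rewrite (raddf_sum (@mxtrace C _)).
  under [RHS]eq_bigr => m my do rewrite linear_sum mulr_sumr /=.
  rewrite [RHS]exchange_big /=; apply: eq_bigr => i _.
  rewrite mxtraceZ BE // mulr_sumr; apply: eq_bigr => m my.
  by rewrite LL LE // mulrCA.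
pose y := #|young N d|.
pose M : 'M[C]_y := \matrix_(i, j) A (enum_val i) (enum_val j).
have sumy (F : shape -> C) :
    \sum_(m in young N d) F m = \sum_(i < y) F (enum_val i).
  by rewrite big_enum_val.
(* A relation between the rows, evaluated on the block unit of one diagram, isolates its coefficient
   times the positive dimension of that block. *)
have uM : M \in unitmx.
  rewrite -row_free_unit -kermx_eq0; apply/rowV0P => c /sub_kermxP cM.
  apply/rowP => j; rewrite [RHS]mxE.
  have jy := enum_valP j.
  have [Y sY [Y1 Y0]] := block_unit jy.
  have E : \sum_i c 0 i * \tr (Rh (enum_val i) Y) = 0.
    under eq_bigr => i _ do rewrite (AL _ _ (enum_valP i) sY) sumy mulr_sumr.
    rewrite exchange_big big1 //= => k _.
    have /rowP/(_ k) := cM; rewrite !mxE => e.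
    under eq_bigr do rewrite mulrA.
    rewrite -mulr_suml (_ : \sum_i _ = 0) ?mul0r // -[RHS]e.
    by apply: eq_bigr => i _; rewrite mxE.
  move: E; rewrite (bigD1 j) //= big1 => [|i ij]; last first.
    rewrite Y0 ?enum_valP ?mxtrace0 ?mulr0 //.
    by rewrite (inj_eq enum_val_inj).
  rewrite addr0 Y1 mxtrace1 => /eqP; rewrite mulf_eq0 => /orP[/eqP//|].
  by rewrite pnatr_eq0 -leqn0 leqNgt (irr jy).1.
have trY Y : symT Y -> (forall l, l \in young N d -> Rh l Y = 0) -> \tr Y = 0.
  move=> sY Y0; pose w : 'cV[C]_y := \col_i L (enum_val i) Y.
  have : M *m w = 0.
    apply/colP => i; rewrite !mxE.
    have := AL _ _ (enum_valP i) sY; rewrite Y0 ?enum_valP // mxtrace0 sumy => e.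
    by rewrite [RHS]e; apply: eq_bigr => j _; rewrite !mxE.
  move=> /(congr1 (mulmx (invmx M))); rewrite mulKmx // mulmx0 => w0.
  rewrite BL // sumy big1 // => i _.
  by have /colP/(_ i) := w0; rewrite !mxE => ->; rewrite mulr0.
(* The commutant is closed under adjoints, so X X^* is also in the kernel; its trace, which
   vanishes, is the sum of the squared moduli of the entries of X. *)
move=> sX X0; have sX' := symT_conj sX.
have /eqP : \tr (X *m (X^T ^ Num.conj)%sesqui) = 0.
  apply: trY => [|l ly]; first exact: symTM.
  by rewrite (extM (RhE ly)) // X0 // mul0mx.
rewrite /mxtrace psumr_eq0 => [/allP z|i _]; last first.
  by rewrite mxE sumr_ge0 // => j _; rewrite !mxE -normCK exprn_ge0.
apply/matrixP => i j; have := z i (mem_index_enum _).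
rewrite mxE psumr_eq0 => [/allP zz|k _]; last by rewrite !mxE -normCK exprn_ge0.
have := zz j (mem_index_enum _); rewrite !mxE -normCK sqrf_eq0 normr_eq0.
by move/eqP.
Qed.

(** The projection onto the commutant. It allows a trace over the commutant to be computed over all
    of End(V^{(x)d}), where the matrix units form a basis. *)
Definition avgT (X : 'M[C]_#|T|) : 'M[C]_#|T| :=
  (d`!%:R)^-1 *: \sum_(s : 'S_d) permT C N s *m X *m permT C N s^-1.

Lemma ent_avgT X I J :
  ent (avgT X) I J = (d`!%:R)^-1 * \sum_(s : 'S_d) ent X (icomp I s) (icomp J s).
Proof.
rewrite entZ ent_sum; congr (_ * _).
rewrite (reindex_inj invg_inj); apply: eq_bigr => s _.
by rewrite ent_mulmx_permT ent_permTM invgK.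
Qed.

Lemma symT_avgT X : symT (avgT X).
Proof.
move=> s I J; rewrite !ent_avgT; congr (_ * _).
rewrite [LHS](reindex_inj (mulIg s^-1%g)) /=; apply: eq_bigr => t _.
by rewrite -!icompM mulgKV.
Qed.

Lemma avgT_id X : symT X -> avgT X = X.
Proof.
move=> sX; apply: ent_inj => I J; rewrite ent_avgT.
under eq_bigr do rewrite sX.
by rewrite sumr_const card_Sn -[X in _ * X]mulr_natl mulKf // pnatr_eq0 -lt0n fact_gt0.
Qed.

Definition unitT (I J : T) : 'M[C]_#|T| :=
  mxT (fun I' J' => ((I' == I) && (J' == J))%:R).

Lemma unitT_sum X : X = \sum_I \sum_J ent X I J *: unitT I J.
Proof.
apply: ent_inj => I J; rewrite ent_sum (bigD1 I) //= [X in _ + X]big1 => [|K KI]; last first.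
  rewrite ent_sum big1 // => K' _.
  by rewrite entZ entE eq_sym (negPf KI) mulr0.
rewrite addr0 ent_sum (bigD1 J) //= [X in _ + X]big1 => [|K KJ]; last first.
  by rewrite entZ entE andbC eq_sym (negPf KJ) mulr0.
by rewrite addr0 entZ entE !eqxx mulr1.
Qed.

Lemma avgT_sum X : avgT X = \sum_I \sum_J ent X I J *: avgT (unitT I J).
Proof.
apply: ent_inj => I J; rewrite ent_avgT ent_sum mulr_sumr.
under [RHS]eq_bigr do rewrite ent_sum.
under [RHS]eq_bigr => I' _.
  under eq_bigr => J' _ do rewrite entZ ent_avgT mulrCA mulr_sumr mulr_sumr.
  rewrite exchange_big /=; over.
rewrite exchange_big /=; apply: eq_bigr => s _.
rewrite {1}(unitT_sum X) ent_sum mulr_sumr; apply: eq_bigr => I' _.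
rewrite ent_sum mulr_sumr; apply: eq_bigr => J' _.
by rewrite entZ.
Qed.

Lemma symT_expmx (X : 'M[C]_#|T|) r : symT X -> symT (X ^+ r).
Proof.
move=> sX; elim: r => [|r IH]; first exact: symT1.
by rewrite exprS; apply: symTM.
Qed.

Lemma ent_unitT A B I J :
  ent (A *m unitT I J *m B) I J = ent A I I * ent B J J.
Proof.
rewrite entM (bigD1 J) //= [X in _ + X]big1 => [|L LJ]; last first.
  rewrite entM [X in X * _]big1 ?mul0r // => K _.
  by rewrite entE (negPf LJ) andbF mulr0.
rewrite addr0 entM (bigD1 I) //= [X in _ + X]big1 => [|L LI]; last first.
  by rewrite entE (negPf LI) mulr0.
by rewrite addr0 entE !eqxx mulr1.
Qed.

(* Both sides compute the trace of X |-> class_sum ^+ r *m avgT X. *)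
Lemma casimir_trace r :
  \sum_(l in young N d) (n l)%:R ^+ 2 * content_sum C l ^+ r =
  (d`!%:R)^-1 * \sum_(s : 'S_d)
    \tr (class_sum C d N ^+ r *m permT C N s) * \tr (permT C N s^-1).
Proof.
pose K := class_sum C d N; have sK : symT (K ^+ r).
  by apply: symT_expmx; apply: symT_class_sum.
have RhK l : l \in young N d -> Rh l (K ^+ r) = (content_sum C l ^+ r)%:M.
  move=> ly; have e := ext_class_sum (irr ly) (hw ly) (RhE ly).
  elim: r {sK} => [|r IH]; first exact: (ext1 (RhE ly)).
  rewrite exprS (extM (RhE ly)).
  - by rewrite e IH -scalar_mxM exprS.
  - exact: symT_class_sum.
  - by apply: symT_expmx; apply: symT_class_sum.
pose b l p q := sval (cid (@matrix_unit l p q)).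
have bP l p q : l \in young N d -> [/\ symT (b l p q), Rh l (b l p q) = delta_mx p q &
    forall m, m \in young N d -> m != l -> Rh m (b l p q) = 0].
  by move=> ly; rewrite /b; case: cid => /= X /(_ ly).
(* The lifted matrix units span the commutant, with the block entries as coordinates: both sides
   agree in every block, and [joint_kernel] applies. *)
have expand X : symT X ->
    X = \sum_(l in young N d) \sum_p \sum_q Rh l X p q *: b l p q.
  move=> sX; apply/eqP; rewrite -subr_eq0; apply/eqP/joint_kernel.
    rewrite -scaleN1r; apply: symTD => //; apply: symTZ.
    apply: symT_sum => l ly; apply: symT_sum => p _; apply: symT_sum => q _.
    by apply: symTZ; have [] := bP l p q ly.
  move=> l ly; rewrite linearB /= linear_sum (bigD1 l) //= [X in _ - (_ + X)]big1.
    rewrite addr0 linear_sum {1}[Rh l X]matrix_sum_delta -sumrB big1 // => p _.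
    rewrite linear_sum -sumrB big1 // => q _.
    by rewrite linearZ /=; have [_ -> _] := bP l p q ly; rewrite subrr.
  move=> m /andP[my ml]; rewrite linear_sum big1 // => p _.
  rewrite linear_sum big1 // => q _; rewrite linearZ /=.
  by have [_ _ ->] := bP m p q my; rewrite // ?scaler0 // eq_sym.
transitivity (\sum_I \sum_J ent (K ^+ r *m avgT (unitT I J)) I J); last first.
  have step I J : ent (K ^+ r *m avgT (unitT I J)) I J = (d`!%:R)^-1 *
      \sum_s ent (K ^+ r *m permT C N s) I I * ent (permT C N s^-1) J J.
    rewrite /avgT -scalemxAr entZ mulmx_sumr ent_sum; congr (_ * _).
    by apply: eq_bigr => s _; rewrite !mulmxA ent_unitT.
  rewrite pair_big /=; under eq_bigr do rewrite step.
  rewrite -mulr_sumr exchange_big /=; congr (_ * _); apply: eq_bigr => s _.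
  rewrite !mxtrace_ent mulr_suml.
  under [RHS]eq_bigr do rewrite mulr_sumr.
  by rewrite pair_big.
have step I J : ent (K ^+ r *m avgT (unitT I J)) I J =
    \sum_(l in young N d) \sum_p \sum_q content_sum C l ^+ r *
      (Rh l (avgT (unitT I J)) p q * ent (b l p q) I J).
  have sZ : symT (K ^+ r *m avgT (unitT I J)).
    by apply: symTM => //; apply: symT_avgT.
  rewrite {1}(expand _ sZ) ent_sum; apply: eq_bigr => l ly.
  rewrite ent_sum; apply: eq_bigr => p _; rewrite ent_sum; apply: eq_bigr => q _.
  rewrite entZ (extM (RhE ly)) //; last exact: symT_avgT.
  by rewrite RhK // mul_scalar_mx mxE mulrA.
(* This is the trace of the rank-one map sending X to the (l, p, q) coordinate of [avgT X] times
   [b l p q]; it is 1 because [avgT] fixes [b l p q]. Summing over p and q gives the square of the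
   dimension. *)
have one l p q : l \in young N d ->
    \sum_I \sum_J Rh l (avgT (unitT I J)) p q * ent (b l p q) I J = 1.
  move=> ly; have [sb be _] := bP l p q ly.
  have := congr1 (fun X : 'M[C]_(urep_dim (W l)) => X p q) be.
  rewrite -{1}(avgT_id sb) avgT_sum mxE !eqxx => e; rewrite -[RHS]e {e}.
  rewrite linear_sum summxE; apply: eq_bigr => I _.
  rewrite linear_sum summxE; apply: eq_bigr => J _.
  by rewrite [Rh l (ent _ _ _ *: _)]linearZ [RHS]mxE mulrC.
rewrite pair_big /=; under [RHS]eq_bigr do rewrite step.
rewrite exchange_big /=; apply: eq_bigr => l ly.
rewrite exchange_big /=.
under [RHS]eq_bigr => p _.
  rewrite exchange_big /=.
  under eq_bigr => q _.
    rewrite -mulr_sumr -(pair_big predT predT (fun I J =>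
      Rh l (avgT (unitT I J)) p q * ent (b l p q) I J)) /= one // mulr1.
    over.
  over.
by rewrite /= !sumr_const !card_ord -mulrnA -[RHS]mulr_natl natrM expr2.
Qed.

End Completeness.

(** * Walks in the Hurwitz-Cayley graph *)

Section TracesOfPermutations.
Variables (C : numClosedFieldType) (d N : nat) (s : 'S_d).
Local Notation T := {ffun 'I_d -> 'I_N}.

Lemma porbit_index_subproof k : (index (porbit s k) (enum (porbits s)) < #|porbits s|)%N.
Proof. by rewrite cardE index_mem mem_enum imset_f. Qed.

Definition porbit_index k : 'I_#|porbits s| := Ordinal (porbit_index_subproof k).

Lemma porbit_indexE k : enum_val (porbit_index k) = porbit s k.
Proof.
by rewrite (enum_val_nth (porbit s k)) nth_index // mem_enum imset_f.
Qed.

Lemma fixed_icomp_porbit (I : T) : I = icomp I s ->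
  forall k l, porbit s k = porbit s l -> I k = I l.
Proof.
move=> e k l kl; have : l \in porbit s k by rewrite kl porbit_id.
case/porbitP => i ->; elim: i => [|i IH]; first by rewrite expg0 perm1.
by rewrite expgSr permM IH {1}e ffunE.
Qed.

(** The trace counts the multi-indices fixed by s, which are those constant on each cycle. *)
Lemma mxtrace_permT : \tr (permT C N s) = (N ^ #|porbits s|)%:R.
Proof.
rewrite mxtrace_ent; under eq_bigr do rewrite entE.
rewrite -natr_sum -big_mkcond sum1_card.
pose f (h : {ffun 'I_#|porbits s| -> 'I_N}) : T := [ffun k => h (porbit_index k)].
have /choice[rep repP] : forall j : 'I_#|porbits s|, exists k, porbit_index k = j.
  move=> j; have /imsetP[k _ e] := enum_valP j.
  by exists k; apply: enum_val_inj; rewrite porbit_indexE.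
have finj : injective f.
  move=> h1 h2 /ffunP e; apply/ffunP => j.
  by have := e (rep j); rewrite !ffunE repP.
transitivity (#|f @: [set: {ffun 'I_#|porbits s| -> 'I_N}]|%:R : C); last first.
  by rewrite card_imset // cardsT card_ffun !card_ord.
congr _%:R; transitivity #|[pred I : T | I == icomp I s]|; first exact: eq_card.
apply: eq_card => I; rewrite inE; apply/eqP/imsetP => [e|[h _ ->]].
  exists [ffun j => I (rep j)]; first by rewrite inE.
  apply/ffunP => k; rewrite !ffunE; apply: (fixed_icomp_porbit e).
  by rewrite -!porbit_indexE repP.
apply/ffunP => k; rewrite !ffunE.
congr (h _); apply: enum_val_inj; rewrite !porbit_indexE; apply/eqP.
by rewrite eq_porbit_mem porbit_sym; have := mem_porbit s 1 k; rewrite expg1.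
Qed.

End TracesOfPermutations.

Section Walks.
Variable d : nat.

Definition walk_sum (V : nmodType) (phi : 'S_d -> V) r (x : 'S_d) : V :=
  \sum_(w : r.-tuple 'S_d | path (@hc_adj d) x w) phi (last x w).

Lemma sum_hc_adj (V : nmodType) (phi : 'S_d -> V) x :
  \sum_(y | hc_adj x y) phi y = \sum_(t in transpositions d) phi (x * t)%g.
Proof.
rewrite (reindex_inj (mulgI x)); apply: eq_bigl => t.
apply/existsP/idP => [[u /andP[tu /eqP/mulgI->]]//|tt].
by exists t; rewrite tt eqxx.
Qed.

Lemma walk_sum0 (V : nmodType) (phi : 'S_d -> V) x : walk_sum phi 0 x = phi x.
Proof.
rewrite /walk_sum (big_pred1 [tuple]) // => w.
by rewrite tuple0 /= eqxx.
Qed.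

Lemma walk_sumS (V : nmodType) (phi : 'S_d -> V) r x :
  walk_sum phi r.+1 x = \sum_(t in transpositions d) walk_sum phi r (x * t)%g.
Proof.
rewrite -sum_hc_adj pair_big_dep /=.
rewrite /walk_sum (reindex (fun p : 'S_d * r.-tuple 'S_d => [tuple of p.1 :: p.2])) //=.
exists (fun w => (thead w, [tuple of behead w])) => [[y w] _|w _] /=.
  by congr pair; apply: val_inj.
by rewrite -tuple_eta.
Qed.

(** One recursion identifies both the group algebra coefficients and the traces on V^{(x)d} with
    sums over walks. *)
Lemma walk_sum_unique (V : nmodType) (phi : 'S_d -> V) (A : nat -> 'S_d -> V) :
  (forall x, A 0%N x = phi x) ->
  (forall r x, A r.+1 x = \sum_(t in transpositions d) A r (x * t)%g) ->
  forall r x, A r x = walk_sum phi r x.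
Proof.
move=> A0 AS; elim=> [|r IH] x; first by rewrite A0 walk_sum0.
by rewrite AS walk_sumS; apply: eq_bigr => t _.
Qed.

Lemma walks_walk_sum (F : pzSemiRingType) a b r : (walks d a b r)%:R =
  \sum_(x in level d a) walk_sum (fun y => (y \in level d b)%:R : F) r x.
Proof.
rewrite /walks -sum1_card natr_sum /walk_sum pair_big_dep /=.
rewrite (eq_bigl (fun w : 'S_d * r.-tuple 'S_d =>
  [&& w.1 \in level d a, path (@hc_adj d) w.1 w.2
        & last w.1 w.2 \in level d b])); last by move=> w; rewrite inE.
under [RHS]eq_bigr do rewrite mulrb.
rewrite -big_mkcondr; apply: eq_bigl => w; by rewrite andbA.
Qed.

Lemma level_invg b (x : 'S_d) : (x^-1%g \in level d b) = (x \in level d b).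
Proof. by rewrite !inE porbitsV. Qed.

Section Hurwitz.
Variable F : fieldType.
Local Notation aG := (regular_repr F [set: 'S_d]%G).

Lemma coef_id_regular g : coef_id (aG g) = (g == 1%g)%:R.
Proof.
rewrite /coef_id /gring_row !mxE gring_indexK ?inE // mul1g eqxx /=.
by rewrite -(inj_eq (can_inj (@gring_valK _ _))) !gring_indexK ?inE // eq_sym.
Qed.

Lemma coef_id_sum (I : finType) (P : pred I) (X : I -> 'M[F]_#|[set: 'S_d]%G|) :
  coef_id (\sum_(i | P i) X i) = \sum_(i | P i) coef_id (X i).
Proof. by rewrite /coef_id linear_sum summxE. Qed.

Lemma hurwitz_walks a b r : hurwitz F d a b r = (walks d a b r)%:R.
Proof.
rewrite walks_walk_sum /hurwitz /set_sum /gset_mx.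
rewrite -mulmxA mulmx_suml coef_id_sum; apply: eq_bigr => x _; rewrite mulmxA.
pose A r x := coef_id (aG x *m (\sum_(t in transpositions d) aG t) ^+ r
  *m (\sum_(y in level d b) aG y)).
rewrite -[LHS]/(A r x); apply: walk_sum_unique => {r x}[x|r x].
  rewrite /A expr0 mulmx1 mulmx_sumr coef_id_sum.
  under eq_bigr do rewrite -repr_mxM ?inE // coef_id_regular.
  (* The identity coefficient of x L_b tests whether x^-1 lies in L_b; levels are stable under
     inversion. *)
  rewrite -level_invg big_mkcond (bigD1 x^-1%g) //= mulgV eqxx big1 ?addr0.
    by case: ifP.
  move=> y yx; case: ifP => // _; case: eqP => // e.
  by move: yx; rewrite -(mulKg x y) e mulg1 eqxx.
rewrite /A exprS -mulmxE mulmxA [aG x *m _]mulmx_sumr !mulmx_suml coef_id_sum.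
by apply: eq_bigr => t _; rewrite repr_mxM ?inE.
Qed.

End Hurwitz.

(** The levels below d partition S_d: when d > 0 every permutation has between 1 and d cycles. *)
Lemma porbits_level (x : 'S_d) (V : nmodType) (G : nat -> V) : (0 < d)%N ->
  \sum_(a < d) (if x \in level d a then G (d - a)%N else 0) = G #|porbits x|.
Proof.
move=> d0; have le_d : (#|porbits x| <= d)%N.
  by rewrite -[X in (_ <= X)%N](card_ord d); apply: leq_imset_card.
have gt0 : (0 < #|porbits x|)%N.
  by apply/card_gt0P; exists (porbit x (Ordinal d0)); rewrite imset_f.
have lt : (d - #|porbits x| < d)%N by rewrite ltn_subrL gt0.
rewrite (bigD1 (Ordinal lt)) //= big1 => [|a ne].
  by rewrite inE subKn // eqxx addr0.
rewrite inE; case: eqP => // e; case/eqP: ne; apply: val_inj => /=.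
by rewrite e subKn // ltnW.
Qed.

End Walks.

Lemma trace_walks (C : numClosedFieldType) d N r : (0 < d)%N ->
  \sum_(s : 'S_d) \tr (class_sum C d N ^+ r *m permT C N s) * \tr (permT C N s^-1)
  = \sum_(a < d) \sum_(b < d) N%:R ^+ (d - a) * N%:R ^+ (d - b) * (walks d a b r)%:R.
Proof.
move=> d0; pose phi (x : 'S_d) : C := N%:R ^+ #|porbits x|.
have trphi x : \tr (permT C N x) = phi x by rewrite mxtrace_permT natrX.
have trA x : \tr (class_sum C d N ^+ r *m permT C N x) = walk_sum phi r x.
  rewrite mxtrace_mulC.
  apply: (walk_sum_unique (A := fun r x => \tr (permT C N x *m class_sum C d N ^+ r))).
    by move=> {}x; rewrite expr0 mulmx1.
  move=> r' {}x; rewrite exprS -mulmxE mulmxA /class_sum mulmx_sumr mulmx_suml raddf_sum.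
  by apply: eq_bigr => t _; rewrite permTM.
have phiE x : phi x = \sum_(b < d) N%:R ^+ (d - b) * (x \in level d b)%:R.
  rewrite /phi -(porbits_level x (fun k => N%:R ^+ k : C)) //.
  by apply: eq_bigr => b _; case: ifP; rewrite ?mulr1 ?mulr0.
have wsE x : walk_sum phi r x = \sum_(b < d) N%:R ^+ (d - b) *
    walk_sum (fun y => (y \in level d b)%:R : C) r x.
  rewrite /walk_sum; under eq_bigr do rewrite phiE.
  by rewrite exchange_big; apply: eq_bigr => b _; rewrite mulr_sumr.
rewrite (eq_bigr (fun x => \sum_(a < d) \sum_(b < d)
    N%:R ^+ (d - a) * N%:R ^+ (d - b) *
    ((x \in level d a)%:R * walk_sum (fun y => (y \in level d b)%:R : C) r x))).
  rewrite exchange_big; apply: eq_bigr => a _ /=.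
  rewrite exchange_big; apply: eq_bigr => b _ /=.
  rewrite -mulr_sumr walks_walk_sum; congr (_ * _); rewrite [RHS]big_mkcond.
  by apply: eq_bigr => x _; case: ifP; rewrite ?mul1r ?mul0r.
move=> x _; rewrite trA trphi /phi porbitsV -/(phi x) phiE wsE mulrC mulr_suml.
apply: eq_bigr => a _; rewrite mulr_sumr; apply: eq_bigr => b _.
by rewrite -!mulrA; congr (_ * _); rewrite mulrCA.
Qed.

(** * Continuous characters of the torus *)

Section CircleCharacters.
Variable R : realType.
Local Notation C := (Num.ClosedField.sort (R[i] : numClosedFieldType)).

Definition circ (x : R) : C := Complex (cos x) (sin x).

Lemma circD x y : circ (x + y) = circ x * circ y.
Proof. by rewrite /circ cosD sinD [sin x * _ + _]addrC. Qed.

Lemma circ0 : circ 0 = 1.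
Proof. by rewrite /circ cos0 sin0. Qed.

Lemma norm_circ x : `|circ x| = 1.
Proof. by rewrite normc_def /= cos2Dsin2 sqrtr1. Qed.

Lemma circ_neq0 x : circ x != 0.
Proof. by rewrite -normr_eq0 norm_circ oner_eq0. Qed.

Lemma circ_pi : circ pi = -1.
Proof. by apply/eqP; rewrite eq_complex /= cospi sinpi oppr0 !eqxx. Qed.

Lemma circ_surj (u : C) : `|u| = 1 -> exists x, u = circ x.
Proof.
case: u => a b; rewrite normc_def /= => -[] /(congr1 (fun x => x ^+ 2)).
rewrite sqr_sqrtr ?addr_ge0 ?sqr_ge0 // expr1n => ab.
have a1 : -1 <= a <= 1.
  rewrite -ler_norml -(@expr_le1 _ 2) // real_normK ?num_real // -ab.
  by rewrite lerDl sqr_ge0.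
have bs : `|b| = sin (acos a).
  by rewrite sin_acos // -ab addrC addKr sqrtr_sqr.
case: (leP 0 b) => b0.
  exists (acos a); rewrite /circ acosK ?in_itv //= -bs ger0_norm //.
exists (- acos a); rewrite /circ cosN sinN acosK ?in_itv //= -bs ltr0_norm //.
by rewrite opprK.
Qed.

Lemma dyadic_approx (x e : R) : 0 < e ->
  exists k (j : int), `|x - pi * j%:~R / 2 ^+ k| < e.
Proof.
move=> e0; pose k := Num.bound (pi / e); exists k.
have p0 : 0 < (pi : R) by exact: pi_gt0.
have k0 : 0 < (2 ^+ k : R) by rewrite exprn_gt0.
have big : pi / e < 2 ^+ k.
  apply: (lt_trans (archi_boundP _)); first by rewrite divr_ge0 // ltW.
  by rewrite -natrX ltr_nat ltn_expl.
pose y := x * 2 ^+ k / pi; exists (Num.floor y).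
have -> : x = pi * y / 2 ^+ k by rewrite /y [pi * _]mulrC divfK ?mulfK ?gt_eqF.
rewrite -mulrBl -mulrBr normrM normrM (gtr0_norm p0) [X in _ * X]gtr0_norm ?invr_gt0 //.
have /andP[fl fu] : 0 <= y - (Num.floor y)%:~R < 1.
  have := floorD1_gt y; rewrite intrD mulr1z => f2.
  by rewrite subr_ge0 floor_le ltrBlDl.
rewrite ger0_norm // ltr_pdivrMr //; apply: (@le_lt_trans _ _ pi).
  by rewrite ler_piMr // ltW.
by rewrite mulrC -ltr_pdivrMr.
Qed.

Lemma eq_dyadic (K : numFieldType) (f g : R -> K) :
  continuous f -> continuous g ->
  (forall k (j : int), f (pi * j%:~R / 2 ^+ k) = g (pi * j%:~R / 2 ^+ k)) ->
  forall x, f x = g x.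
Proof.
move=> cf cg fg x; pose h y := f y - g y.
have ch : continuous h by move=> y; apply: cvgB; [exact: cf|exact: cg].
apply/eqP; rewrite -subr_eq0; apply/negPn/negP => hx.
have := ch x; move=> /cvgrPdist_lt/(_ `|h x|); rewrite normr_gt0 => /(_ hx).
move=> /nbhs_ballP[e /= e0 He]; have [k [j kj]] := dyadic_approx x e0.
by have := He _ kj; rewrite {2}/h fg subrr subr0 ltxx.
Qed.

Lemma circMn x m : circ (x * m%:R) = circ x ^+ m.
Proof.
elim: m => [|m IH]; first by rewrite mulr0 circ0 expr0.
by rewrite -addn1 natrD mulrDr mulr1 circD IH exprD expr1.
Qed.

Lemma circN x : circ (- x) = (circ x)^-1.
Proof.
apply: (mulfI (circ_neq0 x)); rewrite -circD subrr circ0.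
by rewrite mulfV ?circ_neq0.
Qed.

Lemma circMz x (m : int) : circ (x * m%:~R) = circ x ^ m.
Proof.
case: m => m; first by rewrite -exprnP -circMn.
by rewrite NegzE rmorphN mulrN circN -exprnN -circMn.
Qed.

Lemma continuous_circ : continuous circ.
Proof.
move=> x; apply/cvgrPdist_lt => -[e e'] ee.
(* In the order of R[i] a positive element is real. *)
have [e0 ->] : 0 < e /\ e' = 0 by move: ee; rewrite ltcE /= => /andP[/eqP-> ->].
have e2 : 0 < e / 2 by rewrite divr_gt0.
have /cvgrPdist_lt/(_ _ e2) := @continuous_cos R x.
have /cvgrPdist_lt/(_ _ e2) := @continuous_sin R x.
apply: filterS2 => y ys yc; rewrite normc_def /= ltcR.
have -> : e = Num.sqrt (e ^+ 2) by rewrite sqrtr_sqr gtr0_norm.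
rewrite ltr_sqrt ?exprn_gt0 //.
have s1 : `|sin x - sin y| ^+ 2 < (e / 2) ^+ 2 by rewrite ltr_pXn2r ?nnegrE // ltW.
have s2 : `|cos x - cos y| ^+ 2 < (e / 2) ^+ 2 by rewrite ltr_pXn2r ?nnegrE // ltW.
rewrite !real_normK ?num_real // in s1 s2.
have e4 : e ^+ 2 = (e / 2) ^+ 2 * 4 by field.
have : 0 < (e / 2) ^+ 2 by rewrite exprn_gt0.
by rewrite e4; lra.
Qed.

Lemma sqr_inj_Re_gt0 (x y : C) : 0 < complex.Re x -> 0 < complex.Re y ->
  x ^+ 2 = y ^+ 2 -> x = y.
Proof.
move=> x0 y0 /eqP; rewrite eqf_sqr => /orP[/eqP//|/eqP e].
by move: x0; rewrite e; case: y y0 {e} => a b /= a0; rewrite oppr_gt0 ltNge ltW.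
Qed.

Section Character.
Variable chi : R -> C.
Hypotheses (chiD : forall x y, chi (x + y) = chi x * chi y) (chi0 : chi 0 = 1).
Hypothesis chi_cont : continuous chi.
Hypothesis chi_2pi : chi (pi *+ 2) = 1.

Lemma chi_neq0 x : chi x != 0.
Proof.
apply: contraTneq (oner_neq0 C) => e.
by rewrite -chi0 -(subrr x) chiD e mul0r eqxx.
Qed.

Lemma chiMn x m : chi (x * m%:R) = chi x ^+ m.
Proof.
elim: m => [|m IH]; first by rewrite mulr0 chi0 expr0.
by rewrite -addn1 natrD mulrDr mulr1 chiD IH exprD expr1.
Qed.

Lemma chiMz x (m : int) : chi (x * m%:~R) = chi x ^ m.
Proof.
case: m => m; first by rewrite -exprnP -chiMn.
rewrite NegzE rmorphN mulrN -exprnN -chiMn.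
apply: (mulfI (chi_neq0 (x * m.+1%:R))); rewrite -chiD subrr chi0.
by rewrite mulfV ?chi_neq0.
Qed.

Lemma chi_Re_gt0 : exists k0, forall k, (k0 <= k)%N ->
  0 < complex.Re (chi (pi / 2 ^+ k)).
Proof.
have := @chi_cont 0; move=> /cvgrPdist_lt/(_ 1 ltr01)/nbhs_ballP[e /= e0 He].
exists (Num.bound (pi / e)) => k k0.
have p0 : 0 < (pi : R) by exact: pi_gt0.
have : ball (0 : R) e (pi / 2 ^+ k).
  rewrite /ball /= sub0r normrN gtr0_norm ?divr_gt0 ?exprn_gt0 //.
  rewrite ltr_pdivrMr ?exprn_gt0 // mulrC -ltr_pdivrMr //.
  apply: (lt_trans (archi_boundP _)); first by rewrite divr_ge0 // ltW.
  by rewrite -natrX ltr_nat (leq_ltn_trans k0) // ltn_expl.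
move=> /He; rewrite chi0 => /(le_lt_trans (normc_ge_Re _)).
rewrite ltcR; case: (chi _) => a b /=.
by rewrite ltr_norml => /andP[_]; lra.
Qed.

(* For k large, chi (pi / 2 ^ k) is the unique square root of
   chi (pi / 2 ^ (k - 1)) with positive real part, so chi is determined on the
   dyadic multiples of pi by one of its values. *)
Lemma circle_character : exists m : int, forall x, chi x = circ x ^ m.
Proof.
have [k0 Hk] := chi_Re_gt0; have p0 : 0 < (pi : R) by exact: pi_gt0.
have pow2 k : (2 ^+ k : R) != 0 by rewrite expf_neq0 // pnatr_eq0.
have half k : pi / 2 ^+ k = pi / 2 ^+ k.+1 * 2%:R :> R.
  by rewrite exprS invfM mulrCA -mulrA mulrCA mulVf ?pnatr_eq0 // mulr1.
pose z := circ (pi / 2 ^+ k0).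
have zprim : (2 ^ k0.+1).-primitive_root z.
  apply: primitive_root_pow2; first by rewrite pnatr_eq0.
  by rewrite -circMn natrX divfK // circ_pi.
have : chi (pi / 2 ^+ k0) ^+ (2 ^ k0.+1) = 1.
  by rewrite -chiMn expnSr natrM natrX mulrA divfK // mulr_natr chi_2pi.
move=> /(prim_rootP zprim)[i Ei].
(* The exponent is determined modulo 2^(k0+1); its representative closest to 0 is chosen. The
   boundary value 2^k0 is then excluded, as it would give -1, whose real part is negative. *)
have [m [Em m_lo m_hi]] : exists m : int, [/\ chi (pi / 2 ^+ k0) = z ^ m,
    - (2 ^ k0)%:Z < m & m <= (2 ^ k0)%:Z].
  have [le|gt] := leqP i (2 ^ k0).
    exists i; split; rewrite // ?lez_nat //.
    by apply: (@lt_le_trans _ _ 0); rewrite // oppr_lt0 ltz_nat expn_gt0.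
  exists (i%:Z - (2 ^ k0.+1)%:Z); split.
  - rewrite expfzDr ?circ_neq0 // Ei -exprnP -exprnN (prim_expr_order zprim).
    by rewrite invr1 mulr1.
  - by move: gt (ltn_ord i) (expnS 2 k0); lia.
  - by move: gt (ltn_ord i) (expnS 2 k0); lia.
have m_hi' : m < (2 ^ k0)%:Z.
  rewrite lt_neqAle m_hi andbT; apply/eqP => em.
  have := Hk k0 (leqnn _); rewrite Em em -exprnP /z -circMn natrX divfK // circ_pi /=.
  by rewrite oppr_gt0 ltr10.
(* As |m| < 2^k0, the angle is less than pi / 2 in absolute value. *)
have Re_gt0 k : (k0 < k)%N -> 0 < complex.Re (circ (pi * m%:~R / 2 ^+ k)).
  move=> kk; rewrite /= cos_gt0_pihalf //.
  have b : `|m%:~R| < (2 ^+ k0 : R).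
    rewrite -intr_norm -natrX pmulrn ltr_int; lia.
  have c : `|pi * m%:~R / 2 ^+ k| < pi / 2 :> R.
    rewrite 2!normrM (gtr0_norm p0) [X in _ * X]gtr0_norm ?invr_gt0 ?exprn_gt0 //.
    rewrite -mulrA ltr_pM2l // ltr_pdivrMr ?exprn_gt0 //; apply: (lt_le_trans b).
    rewrite mulrC ler_pdivlMr // -exprSr ler_eXn2l ?ltr1n //.
  by move: c; rewrite ltr_norml.
have step k : chi (pi / 2 ^+ (k0 + k)) = circ (pi * m%:~R / 2 ^+ (k0 + k)).
  elim: k => [|k IH]; first by rewrite addn0 Em mulrAC circMz.
  rewrite addnS; apply: sqr_inj_Re_gt0.
  - by apply: Hk; rewrite -addnS leq_addr.
  - by apply: Re_gt0; rewrite ltnS leq_addr.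
  rewrite -chiMn -circMn -half IH; congr circ.
    by rewrite mulrAC (half (k0 + k)%N); ring.
exists m => x; rewrite -circMz.
have cont : continuous (fun y : R => circ (y * m%:~R)).
  move=> y; apply: continuous_comp; last exact: continuous_circ.
  exact: mulrr_continuous.
apply: (@eq_dyadic (R[i] : numClosedFieldType) _ _ chi_cont cont) => k j.
have -> : pi * j%:~R / 2 ^+ k = pi / 2 ^+ (k0 + k) * (j * (2 ^ k0)%:Z)%:~R :> R.
  rewrite intrM -(pmulrn 1 (2 ^ k0)) natrX exprD invfM.
  by field; rewrite !pow2.
rewrite chiMz step -!circMz; congr circ.
by ring.
Qed.

End Character.

End CircleCharacters.

Lemma continuous_conj_entry (R : realType) (K : numFieldType) n
    (F : R -> 'M[K]_n) (P Q : 'M[K]_n) a b :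
  continuous F -> continuous (fun x => (P *m F x *m Q) a b).
Proof.
move=> cF.
have -> : (fun x => (P *m F x *m Q) a b) =
    (fun x => \sum_j (\sum_i P a i * F x i j) * Q j b).
  by apply/funext => y; rewrite mxE; apply: eq_bigr => j _; rewrite mxE.
move=> x; apply: cvg_big => [|j _]; first exact: add_continuous.
apply: cvgM; last exact: cvg_cst.
apply: cvg_big => [|i _]; first exact: add_continuous.
apply: cvgM; first exact: cvg_cst.
apply: (@cvg_comp _ _ _ F (fun M : 'M[K]_n => M i j)); first exact: cF.
exact: coord_continuous.
Qed.

(** The minimal polynomial divides X^(2^(k+1)) - 1, which has distinct roots. *)
Lemma diagonalizable_pow2 (K : numClosedFieldType) n k (A : 'M[K]_n) :
  A ^+ (2 ^ k.+1) = 1 -> diagonalizable_in unitmx A.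
Proof.
case: n A => [|n] A Ak; first by rewrite [A]flatmx0; apply: diagonalizable0.
have [z zm] := exists_prim_root_pow2 K k.
apply/diagonalizableP; exists [seq z ^+ i | i <- iota 0 (2 ^ k.+1)].
  rewrite map_inj_in_uniq ?iota_uniq // => i j.
  rewrite !mem_iota !add0n /= => im jm /eqP.
  by rewrite (eq_prim_root_expr zm) !modn_small // => /eqP.
rewrite big_map.
have := factor_Xn_sub_1 zm; rewrite /index_iota subn0 => ->.
apply: mxminpoly_min; rewrite rmorphB rmorphXn rmorph1 /= horner_mx_X Ak.
by rewrite subrr.
Qed.

Section TorusCharacters.
Variables (R : realType) (N : nat).
Local Notation C := (Num.ClosedField.sort (R[i] : numClosedFieldType)).
Variable rho : unitary_rep (R[i] : numClosedFieldType) N.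
Local Notation n := (urep_dim rho).

Definition coord_row (i : 'I_N) (x : R) : 'rV[C]_N :=
  \row_j if j == i then circ x else 1.

Lemma torus_coord_row i x : torus (coord_row i x).
Proof.
by move=> j; rewrite mxE; case: ifP => _; rewrite ?norm_circ ?normr1.
Qed.

Definition coord_rep i x : 'M[C]_n := rho (diag_mx (coord_row i x)).

Lemma coord_repD i x y : coord_rep i (x + y) = coord_rep i x *m coord_rep i y.
Proof.
rewrite /coord_rep -urepM ?torus_unitary //; try exact: torus_coord_row.
rewrite mulmx_diag; congr (rho (diag_mx _)); apply/rowP => j; rewrite !mxE.
by case: ifP => _; rewrite ?circD ?mulr1.
Qed.

Lemma coord_rep_2pi i : coord_rep i (pi *+ 2) = 1%:M.
Proof.
rewrite -(urep1 rho) -diag_const_mx; congr (rho (diag_mx _)); apply/rowP => j.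
rewrite !mxE; case: ifP => // _.
by rewrite mulr2n circD circ_pi mulrNN mulr1.
Qed.

Lemma coord_repC i j x y :
  coord_rep i x *m coord_rep j y = coord_rep j y *m coord_rep i x.
Proof.
rewrite /coord_rep -!urepM ?torus_unitary //; try exact: torus_coord_row.
by rewrite diag_mxC.
Qed.

Lemma continuous_coord_rep i : continuous (coord_rep i).
Proof.
move=> x.
have cD : continuous (fun x => diag_mx (coord_row i x)).
  move=> y; apply/cvg_ballP => e e0.
  have := @continuous_circ R y; move=> /cvgrPdist_lt/(_ e e0).
  apply: filterS => w hw; split => // a b.
  rewrite !mxE; case: (a == b); last by rewrite !mulr0n; exact: ballxx.
  by rewrite !mulr1n; case: (_ == i) => //; exact: ballxx.
(* Continuity is only relative to the unitary matrices; the path never leaves them. *)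
have := @urep_continuous _ _ rho; move=> /subspace_continuousP cr.
have uD y : diag_mx (coord_row i y) \is unitarymx.
  by apply: torus_unitary; apply: torus_coord_row.
move=> B /(cr _ (uD x)) nB.
have nB' : nbhs x (fun y => diag_mx (coord_row i y) \is unitarymx ->
    B (coord_rep i y)) := cD x _ nB.
by apply: filterS nB' => y; apply.
Qed.

Lemma coord_repMn i x m : coord_rep i (x * m%:R) = coord_rep i x ^+ m.
Proof.
elim: m => [|m IH].
  rewrite mulr0 expr0 -[RHS](urep1 rho) -diag_const_mx.
  congr (rho (diag_mx _)); apply/rowP => j.
  by rewrite !mxE circ0; case: ifP.
by rewrite -addn1 natrD mulrDr mulr1 coord_repD IH exprD expr1.
Qed.

Lemma coord_rep0 i : coord_rep i 0 = 1%:M.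
Proof. by have := coord_repMn i 0 0; rewrite mulr0 expr0. Qed.

Lemma coord_rep_2piz i (j : int) : coord_rep i (pi *+ 2 * j%:~R) = 1%:M.
Proof.
have nat_case m : coord_rep i (pi *+ 2 * m%:R) = 1%:M.
  by rewrite coord_repMn coord_rep_2pi expr1n.
case: j => m; first exact: nat_case.
have := coord_repD i (pi *+ 2 * (Negz m)%:~R) (pi *+ 2 * m.+1%:R).
by rewrite nat_case mulmx1 NegzE rmorphN mulrN addNr coord_rep0.
Qed.

(* The values at the dyadic multiples of pi have finite order and commute, so
   they are codiagonalizable; continuity does the rest. *)
Lemma coord_rep_diagonalize : exists2 P : 'M[C]_n, P \in unitmx &
  forall i x a b, a != b -> (P *m coord_rep i x *m invmx P) a b = 0.
Proof.
pose f (t : 'I_N * (nat * int)) : 'M[C]_n :=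
  coord_rep t.1 (pi * t.2.2%:~R / 2 ^+ t.2.1).
(* Codiagonalization is for finite lists: it is enough to diagonalize a finite family spanning all
   dyadic values. *)
have [gs [_ _ span]] := spanning_family (fun=> True) f.
have [P uP /allP /= PD] : codiagonalizable_in unitmx (map f gs).
  apply/codiagonalizableP; split.
    move=> A B /mapP[[i p] _ ->] /mapP[[j q] _ ->].
    exact: coord_repC.
  move=> A /mapP[[i [k j]] _ ->]; apply: (@diagonalizable_pow2 _ _ k).
  rewrite -coord_repMn -[RHS](coord_rep_2piz i j); congr coord_rep => /=.
  rewrite natrX exprS [2 * _]mulrC mulrA divfK ?expf_neq0 ?pnatr_eq0 //.
  by rewrite mulrAC mulr_natr.
exists P => // i x a b ab.
apply: (@eq_dyadic _ (R[i] : numClosedFieldType)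
  (fun x => (P *m coord_rep i x *m invmx P) a b) (fun=> 0)).
- exact/continuous_conj_entry/continuous_coord_rep.
- by move=> y; exact: cvg_cst.
move=> k j; have szn : size (map f gs) == size gs by rewrite size_map.
have /(coord_span (X := Tuple szn)) := span (i, (k, j)) I.
rewrite {1}/f /= => ->; rewrite mulmx_sumr mulmx_suml summxE big1 // => l _.
rewrite -scalemxAr -scalemxAl mxE.
have /PD : (map f gs)`_l \in map f gs by rewrite mem_nth // size_map.
by move=> /similar_diagPp/(_ a b ab); rewrite conjumx // => ->; rewrite mulr0.
Qed.

Lemma torus_char_urep : torus_char rho.
Proof.
have [P uP PD] := coord_rep_diagonalize.
pose chi i k x := (P *m coord_rep i x *m invmx P) k k.
have conjM A B : P *m (A *m B) *m invmx P =
    (P *m A *m invmx P) *m (P *m B *m invmx P).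
  by rewrite !mulmxA mulmxKV.
have conj1 : P *m 1%:M *m invmx P = 1%:M by rewrite mulmx1 mulmxV.
have chiP i k : exists m : int, forall x, chi i k x = circ x ^ m.
  apply: circle_character.
  - move=> x y; rewrite /chi coord_repD conjM mxE (bigD1 k) //= big1 ?addr0 //.
    by move=> l lk; rewrite PD ?mul0r // eq_sym.
  - by rewrite /chi coord_rep0 conj1 mxE eqxx.
  - exact/continuous_conj_entry/continuous_coord_rep.
  - by rewrite /chi coord_rep_2pi conj1 mxE eqxx.
have /choice[mu muP] : forall p : 'I_n * 'I_N, exists m : int,
    forall x, chi p.2 p.1 x = circ x ^ m by move=> p; apply: chiP.
have conjE u : torus u -> P *m rho (diag_mx u) *m invmx P =
    diag_mx (\row_k \prod_i u 0 i ^ mu (k, i)).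
  move=> tu; have /choice[x xP] : forall i, exists x, u 0 i = circ x.
    by move=> i; apply/circ_surj/tu.
  (* u is built up one coordinate at a time, each step multiplying by a one-parameter factor. *)
  pose v (s : seq 'I_N) : 'rV[C]_N := \row_j if j \in s then u 0 j else 1.
  have tv s : torus (v s).
    by move=> j; rewrite mxE; case: ifP => // _; rewrite normr1.
  have H (s : seq 'I_N) : uniq s -> P *m rho (diag_mx (v s)) *m invmx P =
      diag_mx (\row_k \prod_(i <- s) u 0 i ^ mu (k, i)).
    elim: s => [_|i s IH /= /andP[ns us]].
      have -> : v [::] = const_mx 1 by apply/rowP => j; rewrite !mxE.
      rewrite diag_const_mx urep1 conj1 -diag_const_mx; congr diag_mx.
      by apply/rowP => k; rewrite !mxE big_nil.
    have -> : diag_mx (v (i :: s)) =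
        diag_mx (coord_row i (x i)) *m diag_mx (v s).
      rewrite mulmx_diag; congr diag_mx; apply/rowP => j; rewrite !mxE inE.
      case: eqP => [->|_] /=; first by rewrite (negPf ns) mulr1 xP.
      by rewrite mul1r.
    rewrite urepM ?torus_unitary //; last exact: torus_coord_row.
    rewrite conjM IH // -/(coord_rep i (x i)).
    have -> : P *m coord_rep i (x i) *m invmx P =
        diag_mx (\row_k (u 0 i ^ mu (k, i))).
      apply/matrixP => a b; rewrite [RHS]mxE [X in _ = X *+ _]mxE.
      case: (eqVneq a b) => [<-|ab]; first by rewrite mulr1n xP -(muP (a, i)).
      by rewrite mulr0n PD.
    rewrite mulmx_diag; congr diag_mx; apply/rowP => k.
    by rewrite !mxE big_cons.
  have -> : u = v (index_enum 'I_N).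
    by apply/rowP => j; rewrite mxE mem_index_enum.
  rewrite H ?index_enum_uniq //; congr diag_mx; apply/rowP => k; rewrite !mxE.
  by apply: eq_bigr => i _; rewrite mxE mem_index_enum.
have rhoE u : torus u -> rho (diag_mx u) =
    invmx P *m diag_mx (\row_k \prod_i u 0 i ^ mu (k, i)) *m P.
  by move=> tu; rewrite -conjE // !mulmxA mulVmx // mul1mx mulmxKV.
exists (fun k i => mu (k, i)); split.
  move=> k; exists (invmx P *m delta_mx k 0).
    apply/negP => /eqP /(congr1 (mulmx P)); rewrite mulKVmx // mulmx0.
    by move/matrixP/(_ k 0)/eqP; rewrite !mxE !eqxx oner_eq0.
  move=> u tu; rewrite rhoE // -!mulmxA mulKVmx // scalemxAr; congr (_ *m _).
  apply/matrixP => a b; rewrite mul_diag_mx !mxE.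
  by case: eqP => [->|_] //=; rewrite !mulr0.
move=> u tu; rewrite rhoE // -mulmxA mxtrace_mulC mulmxK // mxtrace_diag.
by apply: eq_bigr => k _; rewrite mxE.
Qed.

End TorusCharacters.

(** * The sphere partition function *)

Lemma content_sum_casimir (C : numClosedFieldType) d N (l : {ffun 'I_N -> 'I_d.+1}) :
  l \in young N d ->
  content_sum C l = ((casimir (row_lengths l))%:~R - N%:R * d%:R) / 2%:R.
Proof.
move=> ly; rewrite /content_sum /casimir -[in d%:R](young_sum ly) natr_sum.
rewrite rmorph_sum mulr_sumr -sumrB mulr_suml; apply: eq_bigr => i _.
rewrite /row_lengths !(rmorphM, rmorphB, rmorphD) /= -!pmulrn -natr1.
by field.
Qed.

Lemma walks_le d a b r : (walks d a b r <= d`! * d`! ^ r)%N.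
Proof.
apply: leq_trans (max_card _) _.
by rewrite card_prod card_tuple card_Sn.
Qed.

Lemma content_moments_complex (C : numClosedFieldType) d N
    (W : {ffun 'I_N -> 'I_d.+1} -> unitary_rep C N) r : (0 < d)%N ->
  (forall l, l \in young N d -> [/\ urep_irreducible (W l),
     has_highest_weight (W l) (row_lengths l) & torus_char (W l)]) ->
  \sum_(l in young N d) (urep_dim (W l))%:R ^+ 2 * content_sum C l ^+ r =
  (d`!%:R)^-1 * \sum_(a < d) \sum_(b < d)
    N%:R ^+ (d - a) * N%:R ^+ (d - b) * (walks d a b r)%:R.
Proof.
move=> d0 hW.
have H l : exists Rh : {linear 'M[C]_#|{ffun 'I_d -> 'I_N}| -> 'M[C]_(urep_dim (W l))},
    l \in young N d -> forall g, g \is unitarymx -> Rh (tens d g) = W l g.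
  have [ly|nly] := boolP (l \in young N d); last by exists \0.
  have [irr hw tch] := hW l ly.
  have [A AE] := mxtrace_urep_mixed_det ly hw tch.
  have [L LE] := mixed_det_functional A.
  have [|Rh RhE] := urep_extension irr (L := L); last by exists Rh.
  by move=> g ug; rewrite LE AE.
have RhE l : l \in young N d -> forall g, g \is unitarymx ->
    sval (cid (H l)) (tens d g) = W l g.
  by move=> ly; case: (cid (H l)) => Rh /= /(_ ly).
rewrite (casimir_trace _ _ RhE) ?trace_walks //; by move=> l /hW[].
Qed.

Section SphereExpansion.
Variables (R : realType) (d N : nat).
Hypotheses (d0 : (0 < d)%N) (dN : (d <= N)%N).
Local Notation shape := {ffun 'I_N -> 'I_d.+1}.
Variable W : shape -> unitary_rep R[i] N.
Hypothesis hW : forall l, l \in young N d ->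
  urep_irreducible (W l) /\ has_highest_weight (W l) (row_lengths l).

Definition real_content (l : shape) : R :=
  ((casimir (row_lengths l))%:~R - N%:R * d%:R) / 2%:R.

Lemma content_sum_real l : l \in young N d ->
  content_sum R[i] l = real_complex R (real_content l).
Proof.
move=> ly; rewrite content_sum_casimir // /real_content.
by rewrite fmorph_div rmorphB rmorphM rmorph_int !rmorph_nat.
Qed.

Lemma content_moments r :
  \sum_(l in young N d) (urep_dim (W l))%:R ^+ 2 * real_content l ^+ r =
  (d`!%:R)^-1 * \sum_(a < d) \sum_(b < d)
    N%:R ^+ (d - a) * N%:R ^+ (d - b) * (walks d a b r)%:R :> R.
Proof.
apply: complexI; rewrite rmorphM fmorphV rmorph_nat !rmorph_sum.
rewrite (eq_bigr (fun l => (urep_dim (W l))%:R ^+ 2 * content_sum R[i] l ^+ r)).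
  rewrite (content_moments_complex r d0); last first.
    by move=> l /hW[irr hw]; split=> //; apply: torus_char_urep.
  congr (_ * _); apply: eq_bigr => a _.
  rewrite rmorph_sum; apply: eq_bigr => b _.
  by rewrite !rmorphM !rmorphXn !rmorph_nat.
by move=> l ly; rewrite rmorphM !rmorphXn rmorph_nat content_sum_real.
Qed.

Variable t : R.
Definition hurwitz_term a b : R^nat := fun r =>
  (- t) ^+ r / (r`!%:R * N%:R ^+ r) * complex.Re (hurwitz R[i] d a b r).

Lemma hurwitz_termE a b r :
  hurwitz_term a b r = exp_coeff (- t / N%:R) r * (walks d a b r)%:R.
Proof.
rewrite /hurwitz_term hurwitz_walks /exp_coeff /= exprMn exprVn invfM.
have -> : complex.Re ((walks d a b r)%:R : R[i]) = (walks d a b r)%:R.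
  by rewrite -(rmorph_nat (real_complex R)).
by congr (_ * _); rewrite -[RHS]mulrA [X in _ = _ * X]mulrC.
Qed.

Lemma hurwitz_term_summable a b : cvgn [normed series (hurwitz_term a b)].
Proof.
(* At most d! (d!)^r walks have r steps, so the exponential series at x, times d!, dominates. *)
pose x := `|t / N%:R| * d`!%:R.
have x0 : 0 <= x by rewrite mulr_ge0.
have cx : cvgn (series (d`!%:R *: exp_coeff x)).
  by apply: is_cvg_seriesZ; exact: is_cvg_series_exp_coeff.
apply: series_le_cvg cx => n; rewrite ?normr_ge0 //.
  by rewrite mulr_ge0 // exp_coeff_ge0.
rewrite /= hurwitz_termE normrM.
have -> : (d`!%:R *: exp_coeff x) n =
    `|t / N%:R| ^+ n / n`!%:R * (d`! * d`! ^ n)%:R.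
  rewrite -[LHS]/(d`!%:R * (x ^+ n / n`!%:R)) /x exprMn natrM natrX.
  by ring.
have -> : `|exp_coeff (- t / N%:R) n| = `|t / N%:R| ^+ n / n`!%:R.
  by rewrite /exp_coeff /= normrM normrX mulNr normrN normfV normr_nat.
by rewrite normr_nat ler_wpM2l ?ler_nat ?walks_le // divr_ge0 ?exprn_ge0.
Qed.

Lemma microchiral_expansion : microchiral t W =
  (expR (- t / 2) * N%:R ^+ 2) ^+ d / d`!%:R *
  \sum_(a < d) \sum_(b < d)
     (N%:R ^+ (a + b))^-1 * limn (series (hurwitz_term a b)).
Proof.
have N0 : (N%:R : R) != 0 by rewrite pnatr_eq0 -lt0n (leq_trans d0).
pose y := - t / N%:R.
pose D l : R := (urep_dim (W l))%:R ^+ 2.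
pose c : R := N%:R ^+ (2 * d) / d`!%:R.
have mom r : \sum_(l in young N d) D l * real_content l ^+ r =
    c * \sum_(a < d) \sum_(b < d) (N%:R ^+ (a + b))^-1 * (walks d a b r)%:R.
  rewrite content_moments /c -mulrA mulrCA; congr (_ * _).
  rewrite mulr_sumr; apply: eq_bigr => a _; rewrite mulr_sumr.
  apply: eq_bigr => b _; rewrite mulrA; congr (_ * _).
  apply: (mulIf (expf_neq0 (a + b) N0)); rewrite divfK ?expf_neq0 //.
  rewrite -!exprD; congr (_ ^+ _).
  by have := ltn_ord a; have := ltn_ord b; lia.
(* The identity of moments makes the partial sums of both sides equal, so only finite sums are
   interchanged and the limits are then compared. *)
have seq_eq n : \sum_(l in young N d) D l * series (exp_coeff (y * real_content l)) n =
    c * \sum_(a < d) \sum_(b < d) (N%:R ^+ (a + b))^-1 * series (hurwitz_term a b) n.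
  rewrite /series /=.
  transitivity (\sum_(0 <= r < n) y ^+ r / r`!%:R *
      \sum_(l in young N d) D l * real_content l ^+ r).
    under eq_bigr do rewrite mulr_sumr.
    rewrite exchange_big; apply: eq_bigr => r _; rewrite mulr_sumr.
    apply: eq_bigr => l _; rewrite /exp_coeff /= exprMn.
    by ring.
  rewrite (eq_bigr (fun r => c * \sum_(a < d) \sum_(b < d)
      (N%:R ^+ (a + b))^-1 * hurwitz_term a b r)).
    rewrite -mulr_sumr exchange_big; congr (_ * _); apply: eq_bigr => a _ /=.
    by rewrite exchange_big; apply: eq_bigr => b _ /=; rewrite mulr_sumr.
  move=> r _; rewrite mom mulrCA; congr (_ * _); rewrite mulr_sumr.
  apply: eq_bigr => a _; rewrite mulr_sumr; apply: eq_bigr => b _.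
  by rewrite hurwitz_termE mulrCA.
have lim_eq : \sum_(l in young N d) D l * expR (y * real_content l) =
    c * \sum_(a < d) \sum_(b < d) (N%:R ^+ (a + b))^-1 * limn (series (hurwitz_term a b)).
  pose s n := \sum_(l in young N d)
    D l * series (exp_coeff (y * real_content l)) n.
  have cl : (s @ \oo --> \sum_(l in young N d) D l * expR (y * real_content l))%classic.
    apply: cvg_big => [|l _]; first exact: add_continuous.
    apply: cvgM; first exact: cvg_cst.
    exact: is_cvg_series_exp_coeff.
  have cr : (s @ \oo --> c * \sum_(a < d) \sum_(b < d)
      (N%:R ^+ (a + b))^-1 * limn (series (hurwitz_term a b)))%classic.
    rewrite (_ : s = fun n => c * \sum_(a < d) \sum_(b < d)
      (N%:R ^+ (a + b))^-1 * series (hurwitz_term a b) n); last first.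
      by apply/funext => n; apply: seq_eq.
    apply: cvgM; first exact: cvg_cst.
    apply: cvg_big => [|a _]; first exact: add_continuous.
    apply: cvg_big => [|b _]; first exact: add_continuous.
    apply: cvgM; first exact: cvg_cst.
    have cs : cvgn (series (hurwitz_term a b)).
      by apply: (@normed_cvg R R^o); exact: hurwitz_term_summable.
    exact: cs.
  by rewrite -(cvg_lim (@Rhausdorff R) cl) -(cvg_lim (@Rhausdorff R) cr).
rewrite /microchiral.
transitivity (expR (- t / 2) ^+ d *
    \sum_(l in young N d) D l * expR (y * real_content l)).
  rewrite mulr_sumr; apply: eq_bigr => l ly.
  rewrite mulrCA; congr (_ * _); rewrite -expRM_natl -expRD; congr expR.
  by rewrite /y /real_content; field.
rewrite lim_eq /c mulrA; congr (_ * _).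
by rewrite exprMn -exprM mulrA.
Qed.

End SphereExpansion.

Local Open Scope classical_set_scope.
Local Open Scope ring_scope.

Theorem theorem5p1 (R : realType) (d N : nat) (hd : (1 <= d)%N)
  (hdN : (d <= N)%N) (t : R) (ht : 0 < t) (z : R) (hz : z = expR (- t / 2))
  (W : {ffun 'I_N -> 'I_d.+1} -> unitary_rep R[i] N)
  (hW : forall l, l \in young N d ->
     urep_irreducible (W l) /\ has_highest_weight (W l) (row_lengths l)) :
  let term (a b : nat) : R^nat := fun r =>
    (- t) ^+ r / (r`!%:R * N%:R ^+ r) * complex.Re (hurwitz R[i] d a b r) in
  [/\ forall a b r, (a < d)%N -> (b < d)%N ->
        hurwitz R[i] d a b r = (walks d a b r)%:R,
      forall a b, (a < d)%N -> (b < d)%N ->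
        cvgn [normed series (term a b)]
    & microchiral t W =
      (z * N%:R ^+ 2) ^+ d / d`!%:R *
      \sum_(a < d) \sum_(b < d)
         (N%:R ^+ (a + b))^-1 * limn (series (term a b)) ].
Proof.
move=> term; split=> [a b r _ _|a b _ _|].
- exact: hurwitz_walks.
- exact: hurwitz_term_summable.
- by rewrite hz; apply: microchiral_expansion.
Qed.
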